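(* Let $p_0>0$, and let $\mathcal{L}$ be a rearrangement invariant space such that $\mathcal{L}$ embeds into $L_p$ and $L_q$ embeds into $\mathcal{L}$, where $\infty>q\ge p\ge p_0$. Then there is a positive constant $c$, depending only upon the quasi-constant of $\mathcal{L}$, the embedding constants (of $\mathcal{L}$ into $L_p$ and of $L_q$ into $\mathcal{L}$), $p_0$ and $q/p$, such that for any finite sequence $(X_n)_{n=1}^N$ of independent random variables with values in a Banach space, $$c^{-1}\bigl(\|U\|_p+\|\ell\|_{\mathcal{L}}\bigr)\le\|U\|_{\mathcal{L}}\le c\bigl(\|U\|_p+\|\ell\|_{\mathcal{L}}\bigr).$$
   Context: $|\cdot|$ denotes the norm of the Banach space. For a random variable $X$ and $t\ge0$, $X^*(t)=\sup\{y\ge0:\Pr(|X|>y)>t\}$ (with $\sup\emptyset=0$); $X^*$, viewed as a random variable on $[0,1]$ with Lebesgue measure, has the same law as $|X|$. For a finite sequence $(X_n)_{n=1}^N$ of independent random variables, $U=\max_{1\le n\le N}\bigl|\sum_{k=1}^nX_k\bigr|$. For $t\ge0$, $\tilde\ell(t)\in[0,\infty]$ is the least number such that $\sum_n\Pr(|X_n|>\tilde\ell(t))\le t$; $\ell(t)=\tilde\ell(t)$ for $0\le t\le1$ and $\ell(t)=0$ for $t>1$; $\ell$ is regarded as a random variable on $[0,1]$ with Lebesgue measure. A rearrangement invariant space is a quasi-normed (complete) space $\mathcal{L}$ of random variables such that $1\in\mathcal{L}$, and if $X^*\le Y^*$ and $Y\in\mathcal{L}$, then $X\in\mathcal{L}$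 and $\|X\|_{\mathcal{L}}\le\|Y\|_{\mathcal{L}}$. Thus membership in $\mathcal{L}$ and $\|X\|_{\mathcal{L}}$ depend only on $X^*$; random variables are identified with $X^*$ on $[0,1]$ for this purpose (so $\|X\|_{\mathcal{L}}=\|X^*\|_{\mathcal{L}}$ regardless of the underlying probability space), and $\|X\|_{\mathcal{L}}=\infty$ if $X\notin\mathcal{L}$. The quasi-constant of $\mathcal{L}$ is the least $K>0$ such that $\|X+Y\|_{\mathcal{L}}\le K(\|X\|_{\mathcal{L}}+\|Y\|_{\mathcal{L}})$ for all $X,Y\in\mathcal{L}$. For rearrangement invariant spaces $\mathcal{L},\mathcal{M}$, $\mathcal{L}$ embeds into $\mathcal{M}$ if there is a positive constant $c$ such that $X\in\mathcal{L}$ implies $X\in\mathcal{M}$ and $\|X\|_{\mathcal{M}}\le c\|X\|_{\mathcal{L}}$; the least such $c$ is the embedding constant. The spaces $L_p$, $0<p\le\infty$, are rearrangement invariant spaces. *)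

(* Defs.v *)
From HB Require Import structures.
From mathcomp Require Import all_boot all_order all_algebra.
From mathcomp Require Import all_classical all_reals all_analysis.

Set Implicit Arguments.
Unset Strict Implicit.
Unset Printing Implicit Defensive.

Import Order.TTheory GRing.Theory Num.Theory.
Import numFieldNormedType.Exports.

Local Open Scope classical_set_scope.
Local Open Scope ring_scope.
Local Open Scope ereal_scope.

(* [0,1] with Lebesgue measure is carried by the whole line: what a function
   does outside [0,1] is invisible to this measure. *)
Definition unit_leb (R : realType) : {measure set (measurableTypeR R) -> \bar R} :=
  mrestr (@lebesgue_measure R) (measurable_itv `[0%R, 1%R]).

(* The maximum with 0 implements the convention sup set0 = 0. *)
Definition rearr (R : realType) (d : measure_display) (T : measurableType d)
    (mu : {measure set T -> \bar R}) (X : T -> R) (t : R) : \bar R :=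
  maxe 0 (ereal_sup [set y%:E | y in
    [set y : R | (0 <= y)%R /\ t%:E < mu [set x | (y < `|X x|)%R]]]).

Definition is_least (R : realType) (A : set R) (c : R) : Prop :=
  A c /\ lbound A c.

(* A bare set of random variables on [0,1] together with a functional,
   which is meaningful only on that set. *)
Record rv_space (R : realType) := RVSpace {
  rv_mem : set (R -> R);
  rv_norm : (R -> R) -> R }.

Definition quasi_constants (R : realType) (L : rv_space R) : set R :=
  [set K | (0 < K)%R /\
    forall X Y : R -> R, rv_mem L X -> rv_mem L Y ->
      (rv_norm L (X \+ Y) <= K * (rv_norm L X + rv_norm L Y))%R].

Record ri_space (R : realType) (L : rv_space R) : Prop := RISpace {
  ri_meas : forall X : R -> R, rv_mem L X ->
    measurable_fun [set: measurableTypeR R] X;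
  ri_add : forall X Y : R -> R, rv_mem L X -> rv_mem L Y -> rv_mem L (X \+ Y)%R;
  ri_scale : forall (a : R) X, rv_mem L X -> rv_mem L (a \*o X)%R;
  ri_norm_ge0 : forall X, rv_mem L X -> (0 <= rv_norm L X)%R;
  ri_norm_eq0 : forall X, rv_mem L X ->
    (rv_norm L X = 0%R <-> {ae unit_leb R, forall t, X t = 0%R});
  ri_normZ : forall (a : R) X, rv_mem L X ->
    rv_norm L (a \*o X)%R = (`|a| * rv_norm L X)%R;
  ri_quasi : quasi_constants L !=set0;
  ri_complete : forall u : nat -> R -> R, (forall n, rv_mem L (u n)) ->
    (forall e : R, (0 < e)%R -> exists n0 : nat, forall m n : nat,
       (n0 <= m)%N -> (n0 <= n)%N -> (rv_norm L (u m \- u n) < e)%R) ->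
    exists2 X, rv_mem L X & rv_norm L (u n \- X)%R @[n --> \oo] --> (0%R : R);
  ri_one : rv_mem L (fun=> 1%R);
  ri_rearr : forall X Y : R -> R,
    measurable_fun [set: measurableTypeR R] X -> rv_mem L Y ->
    (forall t : R, (0 <= t)%R ->
       rearr (unit_leb R) X t <= rearr (unit_leb R) Y t) ->
    rv_mem L X /\ (rv_norm L X <= rv_norm L Y)%R }.

Definition embedding_constants (R : realType) (L M : rv_space R) : set R :=
  [set c | (0 < c)%R /\ forall X : R -> R, rv_mem L X ->
    rv_mem M X /\ (rv_norm M X <= c * rv_norm L X)%R].

Definition Lp (R : realType) (p : R) : rv_space R :=
  RVSpace
    [set X : R -> R | measurable_fun [set: measurableTypeR R] X /\
      'N[unit_leb R]_p%:E[EFin \o X] < +oo]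
    (fun X => fine 'N[unit_leb R]_p%:E[EFin \o X]).

Definition ext_norm (R : realType) (L : rv_space R) (X : R -> R) : \bar R :=
  if `[< rv_mem L X >] then (rv_norm L X)%:E else +oo.

(* On a probability space the rearrangement is finite except possibly at t = 0,
   so fine alters it on a null set only. *)
Definition ri_norm (R : realType) (L : rv_space R) (d : measure_display)
    (T : measurableType d) (P : probability T R) (X : T -> R) : \bar R :=
  ext_norm L (fine \o rearr P X).

Definition borel (R : realType) (B : normedModType R) : set (set B) :=
  <<s (@open B) >>.

(* Borel maps with separable range, i.e. strongly measurable maps: in a
   non-separable space sums of merely Borel maps need not be Borel. *)
Definition random_vector (R : realType) (B : normedModType R)
    (d : measure_display) (T : measurableType d) (X : T -> B) : Prop :=
  (forall A, borel A -> measurable (X @^-1` A)) /\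
  exists2 D : set B, countable D & range X `<=` closure D.

Definition independent_family (R : realType) (B : normedModType R)
    (d : measure_display) (T : measurableType d) (P : probability T R)
    (N : nat) (X : 'I_N -> T -> B) : Prop :=
  forall (J : {set 'I_N}) (A : 'I_N -> set B), (forall n, borel (A n)) ->
    P (\bigcap_(n in [set` J]) (X n @^-1` A n)) =
    \prod_(n in J) P (X n @^-1` A n).

Definition max_partial_sum (R : realType) (B : normedModType R) (T : Type)
    (N : nat) (X : 'I_N -> T -> B) (x : T) : R :=
  (\big[Num.max/0]_(n < N) `|\sum_(k < N | (k <= n)%N) X k x|)%R.

(* The infimum is attained, by right continuity of y |-> P [|X_n| > y]. *)
Definition ell_tilde (R : realType) (B : normedModType R)
    (d : measure_display) (T : measurableType d) (P : probability T R)
    (N : nat) (X : 'I_N -> T -> B) (t : R) : \bar R :=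
  ereal_inf [set y : \bar R | 0 <= y /\
    \sum_(n < N) P [set x | y < `|X n x|%:E] <= t%:E].

Definition ell (R : realType) (B : normedModType R)
    (d : measure_display) (T : measurableType d) (P : probability T R)
    (N : nat) (X : 'I_N -> T -> B) (t : R) : \bar R :=
  if (t <= 1)%R then ell_tilde P X t else 0.

(* Main.v *)
Require Import Defs.
From HB Require Import structures.
From mathcomp Require Import all_boot all_order all_algebra.
From mathcomp Require Import all_classical all_reals all_analysis.
From mathcomp Require Import measurable_realfun lra.

Set Implicit Arguments.
Unset Strict Implicit.
Unset Printing Implicit Defensive.

Import Order.TTheory GRing.Theory Num.Theory.
Import numFieldNormedType.Exports.

Local Open Scope classical_set_scope.
Local Open Scope ring_scope.
Local Open Scope ereal_scope.

(* Hoffmann-Jorgensen: stopping the partial sums when they first exceed [a], and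
   using that what comes after is independent of that time, one gets
     P(U > 3a + m) <= sum_n P(|X_n| > m) + P(U > a)^2.
   Iterating n times squares the tail n times; starting from Markov's bound
   P(U > x |U|_p) <= x^(-p) and taking m = ell(t), it follows that
     P(U > 4^n (t^(-1/(2^n p)) |U|_p + ell(t))) <= D_n t.
   As soon as 2^n >= 2 q/p the function t^(-1/(2^n p)) has bounded norm in L_q,
   hence in the space; the factor D_n only costs a dilation t |-> t/2^m, which is
   bounded by (2K)^m because g(t/2) is equimeasurable with the sum of two
   disjoint copies of g restricted to ]0,1/2[.  Conversely |X_n| <= 2U and
   independence give ell(t) <= 2 U^*(t/4). *)

(** The constant may depend on q/p and [p0] but not on p and q separately, which dictates the order
    of the choices: n comes from q/p, then m from D_n, and [p0] enters only through pi^(1/q) <=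
    (1+pi)^(1/p0), where pi^(1/q) bounds the L_q norm of t^(-1/(2^n p)). Two obstacles shape the
    rest. The stopping argument needs the first exit and the later increments to be events of
    sigma-algebras generated by disjoint blocks of the X_n; as the Banach space may be
    non-separable, measurability of sums is proved by countable covers, directly in those
    sub-sigma-algebras. And U lives on an arbitrary probability space while the norm of the space is
    computed on [0,1], so every comparison is made through tails; in particular L_p norms are
    compared by the layer-cake formula, which needs no p >= 1. *)

(** * Strong measurability of vector-valued maps and of their sums *)

Section strong_measurability.
Context (R : realType) (B : normedModType R) (d : measure_display)
  (T : measurableType d).
Implicit Types f g : T -> B.

(* Strong measurability, phrased by countable covers: unlike plain Borel
   measurability it is visibly stable under addition. *)
Definition sepmeas f := forall e : R, (0 < e)%R ->
  exists (u : nat -> set T) (v : nat -> B),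
  [/\ forall i, measurable (u i), forall x, exists i, u i x
    & forall i x, u i x -> (`|f x - v i| < e)%R].

Lemma sepmeas_cst (b : B) : sepmeas (fun=> b).
Proof.
move=> e e0; exists (fun=> setT), (fun=> b); split => //.
- by move=> x; exists 0%N.
- by move=> _ x _; rewrite subrr normr0.
Qed.

Lemma sepmeasD f g : sepmeas f -> sepmeas g -> sepmeas (fun x => f x + g x)%R.
Proof.
move=> sf sg e e0; have e20 : (0 < e / 2)%R by rewrite divr_gt0.
have [u [v [mu cu fv]]] := sf _ e20; have [u' [v' [mu' cu' gv]]] := sg _ e20.
pose k i : nat * nat := odflt (0, 0)%N (unpickle i).
exists (fun i => u (k i).1 `&` u' (k i).2), (fun i => v (k i).1 + v' (k i).2)%R.
split => [i|x|i x [ux u'x]]; first exact: measurableI.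
- have [[i ui] [j uj]] := (cu x, cu' x).
  by exists (pickle (i, j)); rewrite /k pickleK.
- rewrite opprD addrACA (le_lt_trans (ler_normD _ _))// (splitr e) ltrD//.
  + exact: fv.
  + exact: gv.
Qed.

Lemma sepmeas_sum (I : Type) (r : seq I) (Q : pred I) (f : I -> T -> B) :
  (forall i, Q i -> sepmeas (f i)) -> sepmeas (fun x => \sum_(i <- r | Q i) f i x)%R.
Proof.
move=> sf; elim: r => [|i r IH].
  have -> : (fun x => \sum_(i <- [::] | Q i) f i x)%R = (fun=> 0%R) :> (T -> B).
    by apply/funext => x; rewrite big_nil.
  exact: sepmeas_cst.
have -> : (fun x => \sum_(j <- i :: r | Q j) f j x)%R = (fun x => if Q i
    then (f i x + \sum_(j <- r | Q j) f j x)%R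
    else \sum_(j <- r | Q j) f j x)%R :> (T -> B).
  by apply/funext => x; rewrite big_cons.
by case Qi : (Q i) => //; apply: sepmeasD => //; exact: sf.
Qed.

(** The set where |f| > y is a countable union of pieces of the covers: those of precision 1/(m+1)
    whose centre has norm above y + 1/(m+1). *)
Lemma sepmeas_measurable_norm f : sepmeas f ->
  measurable_fun [set: T] (fun x => `|f x|%R).
Proof.
move=> sf; apply: (measurability _ (RGenOInfty.measurableE R)) => //.
move=> /= _ [_ [y ->] <-]; rewrite setTI preimage_itvoy.
have ie (m : nat) : (0 < m.+1%:R^-1 :> R)%R by rewrite invr_gt0.
have /choice[uv uvP] : forall m : nat, exists uv : (nat -> set T) * (nat -> B),
   [/\ forall i, measurable (uv.1 i), forall x, exists i, uv.1 i x
    & forall i x, uv.1 i x -> (`|f x - uv.2 i| < m.+1%:R^-1)%R].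
  by move=> m; have [u [v h]] := sf _ (ie m); exists (u, v).
rewrite (_ : [set _ | _] = \bigcup_m \bigcup_(i in
    [set i | (y + m.+1%:R^-1 < `|(uv m).2 i|)%R]) (uv m).1 i).
  by apply: bigcupT_measurable => m; apply: bigcup_measurable => i _; case: (uvP m).
apply/seteqP; split => x /=.
- move=> yf; have [m ym] := @ltr_add_invr R _ _ yf.
  have [_ cm fm] := uvP (m.*2.+1); have [i ui] := cm x.
  (* This index has precision 1/(2(m+1)), half of the gap 1/(m+1) between y and |f x|: one half is
     lost in passing to the centre, the other remains. *)
  exists m.*2.+1 => //; exists i => //=.
  have h1 := fm _ _ ui.
  have h2 : (`|f x| - `|(uv m.*2.+1).2 i| <= `|f x - (uv m.*2.+1).2 i|)%R.
    exact: lerB_dist.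
  have h3 : (m.*2.+2%:R^-1 = m.+1%:R^-1 / 2 :> R)%R.
    by rewrite -doubleS -muln2 natrM invfM.
  have aux (a b c e z : R) :
    (b - e <= c -> c < a / 2 -> z + a < b -> z + a / 2 < e)%R by lra.
  by rewrite h3 in h1 *; exact: aux h2 h1 ym.
- move=> [m _ [i /= yi ui]].
  have [_ _ fm] := uvP m; have h1 := fm _ _ ui.
  have h2 : (`|(uv m).2 i| - `|f x| <= `|f x - (uv m).2 i|)%R.
    by rewrite distrC; exact: lerB_dist.
  have aux (a b c e z : R) : (b - e <= c -> c < a -> z + a < b -> z < e)%R by lra.
  exact: aux h2 h1 yi.
Qed.

End strong_measurability.

Lemma borel_sepmeas (R : realType) (B : normedModType R) (d : measure_display)
    (T : measurableType d) (f : T -> B) :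
  (forall A, borel A -> measurable (f @^-1` A)) ->
  (exists2 D : set B, countable D & range f `<=` closure D) -> sepmeas f.
Proof.
move=> mf [D cD fD] e e0.
have D0 : D !=set0.
  have /(fD _) : range f (f point) by exists point.
  by move=> /(_ _ (filterT)) [b []]; exists b.
have /pfcard_geP [|[h]] := cD; first by case: D0 => b Db D0; rewrite D0 in Db.
exists (fun i => f @^-1` (ball (h i) e)), h; split.
- by move=> i; apply: mf; apply: sub_sigma_algebra; exact: ball_open.
- move=> x; have /(fD _) : range f (f x) by exists x.
  move=> /(_ _ (nbhsx_ballx _ _ e0)) [b [Db be]].
  have [i _ hi] := @surj _ _ _ _ h _ Db.
  by exists i; rewrite /= hi; exact: ball_sym.
- by move=> i x /=; rewrite -ball_normE /= distrC.
Qed.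

(** * Independence of the sigma-algebras generated by disjoint blocks of variables *)

Lemma g_sigma_algebra_indep (R : realType) (d : measure_display)
    (T : measurableType d) (P : probability T R) (G : set (set T)) (F : set T) :
  setI_closed G -> G `<=` measurable -> measurable F ->
  (forall E, G E -> P (E `&` F) = P E * P F) ->
  forall E, <<s G >> E -> P (E `&` F) = P E * P F.
Proof.
move=> GI Gm mF GF E.
suff : <<s G >> `<=` [set E | measurable E /\ P (E `&` F) = P E * P F].
  by move=> /[apply] -[].
apply: lambda_system_subset => //; last first.
  by move=> A GA; split; [exact: Gm|exact: GF].
apply/dynkin_lambda_system; split => /=.
- by split => //; rewrite setTI probability_setT mul1e.
- move=> A [mA AF]; split; first exact: measurableC.
  rewrite setIC -setDE measureD//; last first.
    by rewrite -ge0_fin_numE// fin_num_measure.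
  rewrite probability_setC// muleBl ?mul1e// ?fin_num_measure//.
  by congr (_ - _); rewrite setIC; exact: AF.
- move=> A tA mA; have mA' i := (mA i).1; split.
    exact: bigcupT_measurable.
  rewrite setI_bigcupl !measure_bigcup//; last 2 first.
  + by move=> i _; exact: measurableI.
  + exact: trivIset_setIr.
  rewrite muleC -(fineK (fin_num_measure P _ mF)) -nneseriesZl//.
  apply: eq_eseriesr => i _; rewrite fineK ?fin_num_measure// muleC.
  exact: (mA i).2.
Qed.

Section cylinders.
Context (R : realType) (B : normedModType R) (d : measure_display)
  (T : measurableType d) (P : probability T R) (N : nat) (X : 'I_N -> T -> B).

(** A pi-system generating the sigma-algebra of the variables indexed by [J], in the very form on
    which [independent_family] gives the product formula. *)
Definition cylinders (J : {set 'I_N}) : set (set T) :=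
  [set E | exists2 A : 'I_N -> set B, forall n, borel (A n)
     & E = \bigcap_(n in [set` J]) (X n @^-1` A n)].

Lemma borelI (A A' : set B) : borel A -> borel A' -> borel (A `&` A').
Proof. by move=> bA bA'; apply: (@measurableI _ (g_sigma_algebraType (@open B))). Qed.

Lemma setI_closed_cylinders J : setI_closed (cylinders J).
Proof.
move=> _ _ [A bA ->] [A' bA' ->]; exists (fun n => A n `&` A' n).
  by move=> n; exact: borelI.
by rewrite -bigcapI; apply: eq_bigcapr => n _; rewrite preimage_setI.
Qed.

Hypothesis Xm : forall n A, borel A -> measurable (X n @^-1` A).

Lemma cylinders_measurable J : cylinders J `<=` measurable.
Proof.
move=> _ [A bA ->]; apply: fin_bigcap_measurable => [|n _]; first exact: finite_finset.
exact: Xm.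
Qed.

Lemma g_cylinders_measurable J : <<s cylinders J >> `<=` measurable.
Proof.
apply: smallest_sub; first exact: sigma_algebra_measurable.
exact: cylinders_measurable.
Qed.

Hypothesis indepX : independent_family P X.

Lemma cylinders_indep (J J' : {set 'I_N}) E F : [disjoint J & J']%B ->
  cylinders J E -> cylinders J' F -> P (E `&` F) = P E * P F.
Proof.
move=> JJ' [A bA ->] [A' bA' ->].
(* Disjointness lets the two families be glued into one, so that the product formula applies to the
   union of [J] and [J']. *)
pose C n := if n \in J then A n else A' n.
have CJ n : n \in J -> C n = A n by rewrite /C => ->.
have CJ' n : n \in J' -> C n = A' n.
  by move=> nJ'; rewrite /C ifN//; apply: contraTN nJ' => /(disjointFr JJ')->.
have bC n : borel (C n) by rewrite /C; case: ifPn.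
rewrite !indepX//.
rewrite (_ : _ `&` _ = \bigcap_(n in [set` J :|: J']) (X n @^-1` C n)).
  rewrite indepX// (eq_bigl [predU J & J']); last by move=> n; rewrite !inE.
  rewrite bigU//=; congr (_ * _); apply: eq_bigr => n nJ.
  + by rewrite CJ.
  + by rewrite CJ'.
apply/seteqP; split => x /=.
- move=> [h h'] n /=; rewrite inE => /orP[nJ|nJ].
  + by rewrite CJ//; exact: h.
  + by rewrite CJ'//; exact: h'.
- move=> h; split => n /= nJ.
  + by rewrite -CJ//; apply: h => /=; rewrite inE nJ.
  + by rewrite -CJ'//; apply: h => /=; rewrite inE nJ orbT.
Qed.

(** The pi-lambda argument is applied to one side at a time: [F] is first kept fixed while [E] runs
    through the generators, which reduces to a fixed cylinder and varying [F]. *)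
Lemma g_cylinders_indep (J J' : {set 'I_N}) E F : [disjoint J & J']%B ->
  <<s cylinders J >> E -> <<s cylinders J' >> F -> P (E `&` F) = P E * P F.
Proof.
move=> JJ' sE sF.
apply: (@g_sigma_algebra_indep _ _ _ P (cylinders J)) => //.
- exact: setI_closed_cylinders.
- exact: cylinders_measurable.
- exact: g_cylinders_measurable sF.
move=> C cC; rewrite setIC muleC.
apply: (@g_sigma_algebra_indep _ _ _ P (cylinders J')) => //.
- exact: setI_closed_cylinders.
- exact: cylinders_measurable.
- exact: cylinders_measurable cC.
by move=> D cD; rewrite setIC muleC; exact: (cylinders_indep JJ').
Qed.

Lemma cylinders_preimage (J : {set 'I_N}) n A : n \in J -> borel A -> cylinders J (X n @^-1` A).
Proof.
move=> nJ bA; exists (fun m => if m == n then A else setT).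
  move=> m; case: ifPn => // _.
  exact: (@measurableT _ (g_sigma_algebraType (@open B))).
apply/seteqP; split => x /=.
- by move=> Ax m /= mJ; case: eqVneq => // ->.
- by move=> /(_ n nJ); rewrite eqxx.
Qed.

Hypothesis Xsep : forall n, exists2 D : set B, countable D & range (X n) `<=` closure D.

(** Taking the generated sigma-algebra as the measurable structure of the domain makes the results
    on [sepmeas] give measurability with respect to the block [J] alone, as independence
    requires. *)
Lemma g_cylinders_norm_sum (J : {set 'I_N}) (Q : pred 'I_N) (y : R) :
  (forall n, Q n -> n \in J) ->
  <<s cylinders J >> [set x | (y < `|\sum_(n | Q n) X n x|)%R].
Proof.
move=> QJ; pose T' := g_sigma_algebraType (cylinders J).
have : sepmeas (fun x : T' => \sum_(n | Q n) X n x)%R.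
  apply: sepmeas_sum => n Qn; apply: borel_sepmeas; last exact: Xsep.
  move=> A bA; apply: sub_sigma_algebra.
  exact: cylinders_preimage (QJ _ Qn) bA.
move=> /sepmeas_measurable_norm /(_ measurableT `]y, +oo[%classic).
by rewrite setTI preimage_itvoy; apply; exact: measurable_itv.
Qed.

End cylinders.

(** * Partial sums and their maximum *)

Section partial_sums.
Context (R : realType) (B : normedModType R) (T : Type) (N : nat)
  (X : 'I_N -> T -> B).

(** Indexed by the number of summands: [psum n.+1] is the sum inside [max_partial_sum], and [psum 0]
    is the empty sum preceding the first step. *)
Definition psum (k : nat) (x : T) : B := (\sum_(i < N | (i < k)%N) X i x)%R.

Lemma psum0 x : psum 0 x = 0%R.
Proof. by rewrite /psum big_pred0. Qed.

Lemma psumS (n : 'I_N) x : psum n.+1 x = (psum n x + X n x)%R.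
Proof.
rewrite /psum (bigD1 n)//= addrC; congr (_ + _)%R; apply: eq_bigl => i.
by rewrite ltnS ltn_neqAle andbC.
Qed.

Lemma psumB j k x : (k <= j)%N ->
  (psum j x - psum k x = \sum_(i < N | (k <= i < j)%N) X i x)%R.
Proof.
move=> kj; rewrite /psum (bigID (fun i : 'I_N => (i < k)%N))/=.
rewrite [in LHS](eq_bigl (fun i : 'I_N => (i < k)%N)); last first.
  by move=> i /=; rewrite andb_idl// => ik; exact: leq_trans kj.
by rewrite addrAC subrr add0r; apply: eq_bigl => i; rewrite -leqNgt andbC.
Qed.

Lemma max_partial_sum_ge0 x : (0 <= max_partial_sum X x)%R.
Proof.
by rewrite /max_partial_sum; elim/big_rec: _ => // n y _ y0; rewrite le_max y0 orbT.
Qed.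

Lemma norm_psumS_le (n : 'I_N) x : (`|psum n.+1 x| <= max_partial_sum X x)%R.
Proof. by rewrite /max_partial_sum (bigD1 n)//= le_max lexx. Qed.

Lemma norm_psum_le k x : (k <= N)%N -> (`|psum k x| <= max_partial_sum X x)%R.
Proof.
case: k => [_|k kN]; first by rewrite psum0 normr0 max_partial_sum_ge0.
exact: (norm_psumS_le (Ordinal kN)).
Qed.

Lemma max_partial_sum_gt (y : R) x : (0 <= y)%R ->
  (y < max_partial_sum X x)%R <-> exists n : 'I_N, (y < `|psum n.+1 x|)%R.
Proof.
move=> y0; split => [|[n] /lt_le_trans]; last by apply; exact: norm_psumS_le.
rewrite /max_partial_sum; elim/big_rec: _ => [|n z _ IH].
  by move=> /(le_lt_trans y0); rewrite ltxx.
by rewrite lt_max => /orP[yn|/IH//]; exists n.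
Qed.

Lemma norm_le_max_partial_sum (n : 'I_N) x :
  (`|X n x| <= 2 * max_partial_sum X x)%R.
Proof.
have -> : X n x = (psum n.+1 x - psum n x)%R by rewrite psumS addrC addKr.
rewrite (le_trans (ler_normB _ _))// mulr2n mulrDl mul1r lerD ?norm_psum_le//.
exact: ltnW.
Qed.

End partial_sums.

Lemma fsbig_setT_fin (R : Type) (idx : R) (op : Monoid.com_law idx)
    (I : finType) (F : I -> R) :
  \big[op/idx]_(i \in [set: I]) F i = \big[op/idx]_i F i.
Proof.
rewrite (_ : [set: I] = [set` predT]); last by apply/seteqP; split.
by rewrite -(@bigfs _ _ _ _ (index_enum I)) ?index_enum_uniq// => i _; rewrite mem_index_enum.
Qed.

Lemma content_sub_sum (d : measure_display) (R : realType)
    (T : measurableType d) (mu : {measure set T -> \bar R}) (I : finType)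
    (A : set T) (F : I -> set T) :
  measurable A -> (forall i, measurable (F i)) -> A `<=` \bigcup_i F i ->
  mu A <= \sum_i mu (F i).
Proof.
move=> mA mF AF; rewrite -fsbig_setT_fin.
by apply: content_sub_fsum => //; exact: finite_finset.
Qed.

Lemma measure_bigcup_fin (d : measure_display) (R : realType)
    (T : measurableType d) (mu : {measure set T -> \bar R}) (I : finType)
    (F : I -> set T) :
  (forall i, measurable (F i)) -> trivIset setT F ->
  mu (\bigcup_i F i) = \sum_i mu (F i).
Proof.
move=> mF tF; rewrite -fsbig_setT_fin.
by apply: measure_fin_bigcup => //; exact: finite_finset.
Qed.

(** * The Hoffmann-Jorgensen inequality *)

Section hoffmann_jorgensen.
Context (R : realType) (B : normedModType R) (d : measure_display)
  (T : measurableType d) (P : probability T R) (N : nat) (X : 'I_N -> T -> B).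
Hypothesis rX : forall n, random_vector (X n).
Hypothesis indepX : independent_family P X.

Let Xm n A (bA : borel A) : measurable (X n @^-1` A) := (rX n).1 A bA.
Let Xsep n := (rX n).2.
Let U := max_partial_sum X.

Lemma measurable_norm_sum (Q : pred 'I_N) (y : R) :
  measurable [set x | (y < `|\sum_(n | Q n) X n x|)%R].
Proof.
apply: (@g_cylinders_measurable _ _ _ _ _ X Xm [set: 'I_N]%SET).
by apply: g_cylinders_norm_sum => // n _; rewrite inE.
Qed.

Lemma measurable_norm_gt (n : 'I_N) (y : R) : measurable [set x | (y < `|X n x|)%R].
Proof.
have := measurable_norm_sum (pred1 n) y.
by under eq_set do rewrite big_pred1_eq.
Qed.

Lemma max_partial_sum_gtE (y : R) : (0 <= y)%R ->
  [set x | (y < U x)%R] = \bigcup_(n : 'I_N) [set x | (y < `|psum X n.+1 x|)%R].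
Proof.
move=> y0; apply/seteqP; split => x /=.
  by move=> /(max_partial_sum_gt _ _ y0)[n yn]; exists n.
by move=> [n _ yn]; apply/(max_partial_sum_gt _ _ y0); exists n.
Qed.

Lemma measurable_max_partial_sum : measurable_fun [set: T] U.
Proof.
apply: (measurability _ (RGenOInfty.measurableE R)) => //.
move=> /= _ [_ [y ->] <-]; rewrite setTI preimage_itvoy.
have [y0|y0] := leP 0%R y.
  rewrite max_partial_sum_gtE//; apply: fin_bigcup_measurable => //= n _.
  exact: measurable_norm_sum.
rewrite (_ : [set _ | _] = setT)//; apply/seteqP; split => // x _ /=.
by rewrite (lt_le_trans y0)// max_partial_sum_ge0.
Qed.

Lemma hoffmann_jorgensen (a m : R) : (0 <= a)%R -> (0 <= m)%R ->
  P [set x | (3 * a + m < U x)%R] <=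
  \sum_(n < N) P [set x | (m < `|X n x|)%R] +
  P [set x | (a < U x)%R] * P [set x | (a < U x)%R].
Proof.
move=> a0 m0.
(* [E k] is a first exit at [k], [F k] a large block strictly after [k]. The level 2a serves twice:
   it is what remains of 3a + m after |S_k| <= a + m, and a difference of two partial sums above 2a
   forces one of them above a. *)
pose E (k : 'I_N) := [set x | (a < `|psum X k.+1 x|)%R] `\`
  \bigcup_(j in [set j : 'I_N | (j < k)%N]) [set x | (a < `|psum X j.+1 x|)%R].
pose F (k : 'I_N) := \bigcup_(j in [set j : 'I_N | (k < j)%N])
  [set x | (2 * a < `|\sum_(i < N | (k.+1 <= i < j.+1)%N) X i x|)%R].
have sE (k : 'I_N) : <<s cylinders X [set i : 'I_N | (i < k.+1)%N]%SET >> (E k).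
  pose T' := g_sigma_algebraType (cylinders X [set i : 'I_N | (i < k.+1)%N]%SET).
  apply: (@measurableD _ T').
    by apply: g_cylinders_norm_sum => // n; rewrite inE.
  apply: (@fin_bigcup_measurable _ T') => // j /= jk.
  apply: g_cylinders_norm_sum => // n nj; rewrite inE (leq_trans nj)//.
  exact: ltnW.
have sF (k : 'I_N) : <<s cylinders X [set i : 'I_N | (k < i)%N]%SET >> (F k).
  pose T' := g_sigma_algebraType (cylinders X [set i : 'I_N | (k < i)%N]%SET).
  apply: (@fin_bigcup_measurable _ T') => // j /= jk.
  by apply: g_cylinders_norm_sum => // n /andP[kn _]; rewrite inE.
have mE k : measurable (E k) by exact: g_cylinders_measurable (sE k).
have mF k : measurable (F k) by exact: g_cylinders_measurable (sF k).
have mU y : measurable [set x | (y < U x)%R].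
  have := measurable_max_partial_sum measurableT (measurable_itv `]y, +oo[).
  by rewrite setTI preimage_itvoy.
have EF k : P (E k `&` F k) = P (E k) * P (F k).
  apply: (g_cylinders_indep Xm indepX _ (sE k) (sF k)).
  rewrite -setI_eq0; apply/eqP/setP => i; rewrite !inE ltnS.
  by case: leqP.
have FU k : P (F k) <= P [set x | (a < U x)%R].
  apply: le_measure; rewrite ?inE// => x [j /= kj].
  rewrite -psumB; last by rewrite ltnW.
  move=> h; have := norm_psum_le X x (ltn_ord j); have := norm_psum_le X x (ltn_ord k).
  have := ler_normB (psum X j.+1 x) (psum X k.+1 x); rewrite /U; lra.
have tE : trivIset setT E.
  apply/trivIsetP => i j _ _; wlog ij : i j / (i < j)%N.
    move=> H ij; case: (ltngtP i j) => [|ji|/val_inj ij'].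
    + by move=> /H; exact.
    + by rewrite setIC; apply: H => //; rewrite eq_sym.
    + by rewrite ij' eqxx in ij.
  move=> _; apply/seteqP; split => // x [[/= h1 _] [_]]; apply.
  by exists i.
have EU : \sum_(k < N) P (E k) <= P [set x | (a < U x)%R].
  rewrite -measure_bigcup_fin//; apply: le_measure; rewrite ?inE//.
    exact: fin_bigcup_measurable.
  move=> x [k _ [/= h _]]; apply/(max_partial_sum_gt _ _ a0).
  by exists k.
(* The event U > 3a + m is covered by these sets: either some summand exceeds m, or the first exit
   is followed by a block above 2a. *)
pose V (i : 'I_N + 'I_N) := match i with
  | inl n => [set x | (m < `|X n x|)%R] | inr k => E k `&` F k end.
apply: (@le_trans _ _ (\sum_i P (V i))).
  apply: content_sub_sum => [//|[n|k]|x /= Ux].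
  - exact: measurable_norm_gt.
  - exact: measurableI.
  have [[n mn]|/forallNP Xn] := pselect (exists n, (m < `|X n x|)%R).
    by exists (inl n).
  have {}Xn n : (`|X n x| <= m)%R by rewrite leNgt; apply/negP/Xn.
  have [|j jx] := (max_partial_sum_gt _ _ _).1 Ux.
    by rewrite addr_ge0// mulr_ge0.
  have aj : (a < `|psum X j.+1 x|)%R by lra.
  have [k ak kmin] := @arg_minnP _ j (fun i : 'I_N => (a < `|psum X i.+1 x|)%R)
    (fun i : 'I_N => i : nat) aj.
  (* The sum just before the first exit: by minimality of [k], or because it is empty when [k] is
     0. *)
  have Sk : (`|psum X k x| <= a)%R.
    have [->|k0] := eqVneq (k : nat) 0%N; first by rewrite psum0 normr0.
    have kN : (k.-1 < N)%N by rewrite (leq_ltn_trans (leq_pred _)).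
    rewrite leNgt; apply/negP => ak'.
    have := kmin (Ordinal kN); rewrite /= prednK ?lt0n// => /(_ ak').
    by rewrite leqNgt ltn_predL lt0n k0.
  have Sk1 : (`|psum X k.+1 x| <= a + m)%R.
    by rewrite psumS (le_trans (ler_normD _ _))// lerD.
  have kj : (k < j)%N.
    rewrite ltn_neqAle kmin ?andbT; last by lra.
    by apply: contraTN jx => /eqP/val_inj <-; rewrite -leNgt; lra.
  exists (inr k) => //=; split.
    split => // -[i /= ik ai]; have := kmin i ai.
    by rewrite leqNgt ik.
  exists j => //=; rewrite -psumB; last exact: ltnW.
  have : (`|psum X j.+1 x| - `|psum X k.+1 x| <= `|psum X j.+1 x - psum X k.+1 x|)%R.
    exact: lerB_dist.
  by lra.
rewrite big_sumType/= leeD//.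
rewrite (@le_trans _ _ (\sum_(k < N) P (E k) * P [set x | (a < U x)%R]))//.
  by apply: lee_sum => k _; rewrite EF lee_wpmul2l.
by rewrite -ge0_sume_distrl// lee_wpmul2r.
Qed.

End hoffmann_jorgensen.

(** * Iterated tail bounds and the truncation level *)

(** Continuity from above, as the sets where f > n decrease to the empty set. This makes [ell_tilde]
    and [rearr] finite at every t > 0. *)
Lemma exists_tail_le (R : realType) (d : measure_display) (T : measurableType d)
    (P : probability T R) (f : T -> R) (t : R) :
  measurable_fun [set: T] f -> (0 < t)%R ->
  exists2 y : R, (0 <= y)%R & P [set x | (y < f x)%R] <= t%:E.
Proof.
move=> mf t0; pose F (n : nat) := [set x | (n%:R < f x)%R].
have mF n : measurable (F n).
  by have := mf measurableT _ (measurable_itv `]n%:R, +oo[); rewrite setTI preimage_itvoy.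
have F0 : \bigcap_n F n = set0.
  apply/seteqP; split => // x /(_ (Num.truncn `|f x|).+1 I); rewrite /F/=.
  have := truncnS_gt `|f x|%R; have := ler_norm (f x) => h1 h2 h3.
  by have := lt_trans h2 h3; rewrite ltNge h1.
have : P \o F @ \oo --> P (\bigcap_n F n).
  apply: nonincreasing_cvg_mu => //.
  - by rewrite -ge0_fin_numE// fin_num_measure.
  - by rewrite F0.
  - move=> m n mn; apply/subsetPset => x; rewrite /F/=; apply: le_lt_trans.
    by rewrite ler_nat.
rewrite F0 measure0 => /fine_cvgP[_ /cvgr0_norm_le /(_ _ t0)] [n _ /(_ n (leqnn n))].
rewrite /= ger0_norm ?fine_ge0// => h; exists n%:R => //.
by rewrite -(fineK (fin_num_measure P _ (mF n))) lee_fin.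
Qed.

(** The D_n of the tail bound: at each step the large summands contribute 1 and the squared tail
    contributes the square of the previous constant. *)
Fixpoint hj_const (R : realType) (n : nat) : R :=
  if n is n'.+1 then (1 + hj_const R n' ^+ 2)%R else 1%R.

(** Induction on (1 - a)(1 + a + b) = 1 + b - a^2 - a b <= 1 + b for nonnegative a and b. *)
Lemma prodB_sum_le (R : realType) (I : Type) (r : seq I) (p : I -> R) :
  (forall i, 0 <= p i)%R -> (forall i, p i <= 1)%R ->
  (\prod_(i <- r) (1 - p i) * (1 + \sum_(i <- r) p i) <= 1)%R.
Proof.
move=> p0 p1; elim: r => [|i r IH]; first by rewrite !big_nil addr0 mulr1.
rewrite !big_cons; apply: le_trans IH.
rewrite (mulrC (1 - p i)%R) -mulrA; apply: ler_wpM2l.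
  by apply: prodr_ge0 => j _; rewrite subr_ge0.
have : (0 <= \sum_(j <- r) p j)%R by apply: sumr_ge0.
by have := p0 i; move: (p i) (\sum_(j <- r) p j)%R => a b; nra.
Qed.

Section tails.
Context (R : realType) (B : normedModType R) (d : measure_display)
  (T : measurableType d) (P : probability T R) (N : nat) (X : 'I_N -> T -> B).
Hypothesis rX : forall n, random_vector (X n).

Let U := max_partial_sum X.

Lemma measurable_max_partial_sum_gt y : measurable [set x | (y < U x)%R].
Proof.
have := measurable_max_partial_sum rX measurableT (measurable_itv `]y, +oo[).
by rewrite setTI preimage_itvoy.
Qed.

(* Iterating the Hoffmann-Jorgensen inequality squares the tail at the cost of
   a factor 4 in the level, as long as the largest summand is negligible. *)
Lemma hoffmann_jorgensen_iter (n : nat) (A m u : R) : independent_family P X ->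
  (0 <= m <= A)%R -> (0 <= u <= 1)%R ->
  P [set x | (A < U x)%R] <= u%:E ->
  \sum_(k < N) P [set x | (m < `|X k x|)%R] <= (u ^+ (2 ^ n))%:E ->
  P [set x | (4 ^+ n * A < U x)%R] <= (hj_const R n * u ^+ (2 ^ n))%:E.
Proof.
move=> indepX /andP[m0 mA] /andP[u0 u1] UA Xm.
have A0 : (0 <= A)%R by exact: le_trans mA.
(* One level m serves all steps: u <= 1 gives u^(2^n) <= u^(2^(i+1)), and m <= A <= 4^i A gives 3
   (4^i A) + m <= 4^(i+1) A. *)
suff: forall i, (i <= n)%N ->
    P [set x | (4 ^+ i * A < U x)%R] <= (hj_const R i * u ^+ (2 ^ i))%:E.
  by apply.
elim=> [_|i IH iN]; first by rewrite expr0 !mul1r expn0 expr1.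
have A40 : (A <= 4 ^+ i * A)%R by rewrite ler_peMl// exprn_ege1// ler1n.
apply: (@le_trans _ _ (P [set x | (3 * (4 ^+ i * A) + m < U x)%R])).
  apply: le_measure; rewrite ?inE; try exact: measurable_max_partial_sum_gt.
  by move=> x /=; apply: le_lt_trans; rewrite exprS; lra.
apply: (le_trans (hoffmann_jorgensen rX indepX _ m0)); first exact: le_trans A40.
have {}IH := IH (ltnW iN).
rewrite /= mulrDl mul1r EFinD leeD//.
  apply: le_trans Xm _; rewrite lee_fin; apply: ler_wiXn2l => //.
  by rewrite leq_exp2l.
rewrite (le_trans (lee_pmul _ _ IH IH))// -EFinM lee_fin.
by rewrite expnS mulnC exprM expr2 mulrACA -!expr2.
Qed.

Lemma ell_tilde_ge0 t : 0 <= ell_tilde P X t.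
Proof. by apply: le_ereal_inf_tmp => y []. Qed.

Lemma ell_tilde_nonincreasing s t : (s <= t)%R -> ell_tilde P X t <= ell_tilde P X s.
Proof.
move=> st; apply: ereal_inf_le_tmp => y [y0 h]; split => //.
by apply: le_trans h _; rewrite lee_fin.
Qed.

Lemma lt_sum_tails (y t : R) : (0 <= y)%R -> y%:E < ell_tilde P X t ->
  t%:E < \sum_(n < N) P [set x | (y < `|X n x|)%R].
Proof.
move=> y0; apply: contraTT; rewrite -!leNgt => h.
by apply: ereal_inf_lbound; split; rewrite ?lee_fin.
Qed.

(** Working strictly above the infimum avoids its attainment; the price is the extra e > 0 in
    [max_partial_sum_tail]. *)
Lemma sum_tails_le (y t : R) : ell_tilde P X t < y%:E ->
  \sum_(n < N) P [set x | (y < `|X n x|)%R] <= t%:E.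
Proof.
move=> /ereal_inf_lt[z [z0 zt] zy]; apply: le_trans zt; apply: lee_sum => n _.
have z_fin : z \is a fin_num by rewrite ge0_fin_numE// (lt_trans zy)// ltry.
move: z zy z0 z_fin => [z| |]//; rewrite lte_fin => zy _ _.
apply: le_measure; rewrite ?inE; try exact: measurable_norm_gt.
by move=> x /=; exact: lt_trans.
Qed.

Lemma ell_tilde_fin (t : R) : (0 < t)%R -> ell_tilde P X t \is a fin_num.
Proof.
move=> t0; rewrite ge0_fin_numE ?ell_tilde_ge0//.
(* Each of the N tails gets at most this share of t, through |X_n| <= 2U; dividing by N + 1 covers N
   = 0. *)
have tN : (0 < t / N.+1%:R)%R by rewrite divr_gt0.
have m2U : measurable_fun [set: T] (fun x => 2 * U x)%R.
  by apply: measurable_funM => //; exact: measurable_max_partial_sum.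
have [y y0 yt] := exists_tail_le P m2U tN.
apply: le_lt_trans (ltry y); apply: ereal_inf_lbound; split; first by rewrite lee_fin.
apply: (@le_trans _ _ (\sum_(n < N) (t / N.+1%:R)%:E)).
  apply: lee_sum => n _; apply: le_trans yt; apply: le_measure; rewrite ?inE.
  - exact: measurable_norm_gt.
  - by have := m2U measurableT _ (measurable_itv `]y, +oo[); rewrite setTI preimage_itvoy.
  move=> x /=; rewrite lte_fin => /lt_le_trans; apply.
  exact: norm_le_max_partial_sum.
rewrite sumEFin lee_fin sumr_const card_ord -(mulr_natr (t / _)%R) -mulrA ler_piMr ?ltW//.
by rewrite ltr_pdivrMl// mulr1 ltr_nat.
Qed.

(* [P(max |X_n| > y) = 1 - prod (1 - p_n) >= s / (1 + s)] with [s = sum p_n]. *)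
Lemma sum_tails_le_max (y t : R) : independent_family P X -> (0 <= t <= 1)%R ->
  t%:E < \sum_(n < N) P [set x | (y < `|X n x|)%R] ->
  (t / 2)%:E < P [set x | (y / 2 < U x)%R].
Proof.
move=> indepX /andP[t0 t1]; pose p n := fine (P [set x | (y < `|X n x|)%R]).
have pE n : P [set x | (y < `|X n x|)%R] = (p n)%:E.
  by rewrite fineK// fin_num_measure//; exact: measurable_norm_gt.
have p0 n : (0 <= p n)%R by rewrite -lee_fin -pE.
have p1 n : (p n <= 1)%R by rewrite -lee_fin -pE; apply: probability_le1; exact: measurable_norm_gt.
under eq_bigr do rewrite pE; rewrite sumEFin lte_fin => ts.
have prodp := prodB_sum_le (index_enum 'I_N) p0 p1.
have oA : borel [set b : B | (y < `|b|)%R].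
  apply: sub_sigma_algebra.
  rewrite (_ : [set _ | _] = Num.norm @^-1` [set z : R | (y < z)%R])//.
  apply: open_comp; last exact: open_gt.
  by move=> b _; exact: norm_continuous.
have bA : borel (~` [set b : B | (y < `|b|)%R]) by exact: sigma_algebraC.
have := indepX [set: 'I_N]%SET _ (fun=> bA).
rewrite (eq_bigr (fun n => (1 - p n)%:E)); last first.
  move=> n _; rewrite preimage_setC probability_setC; last exact: measurable_norm_gt.
  by rewrite pE EFinB.
rewrite prodEFin => PA.
pose E := \bigcap_(n in [set` [set: 'I_N]%SET]) (X n @^-1` ~` [set b : B | (y < `|b|)%R]).
have mE : measurable E.
  apply: fin_bigcap_measurable => [|n _]; first exact: finite_finset.
  exact: (rX n).1.
apply: (@lt_le_trans _ _ (P (~` E))); last first.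
  apply: le_measure; rewrite ?inE.
  - exact: measurableC.
  - exact: measurable_max_partial_sum_gt.
  move=> x /= /existsNP[n /= /not_implyP[_ /contrapT /= yn]].
  have := norm_le_max_partial_sum X n x; rewrite -/U => h.
  by rewrite ltr_pdivrMr// mulrC; exact: lt_le_trans h.
rewrite probability_setC// [P E]PA -EFinB lte_fin.
under eq_bigl do rewrite inE.
(* Q <= 1/(1 + s) and s > t give 1 - Q > t/(1 + t), which is at least t/2 because t <= 1. *)
move: prodp ts; set Q := (\prod_(n < N) _)%R; set s := (\sum_(n < N) _)%R.
nra.
Qed.

End tails.

(** * The decreasing rearrangement *)

Section rearrangement.
Context (R : realType) (d : measure_display) (T : measurableType d).

Lemma rearr_ge0 (mu : {measure set T -> \bar R}) (f : T -> R) (t : R) :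
  0 <= rearr mu f t.
Proof. by rewrite /rearr le_max lexx. Qed.

Lemma rearr_nonincreasing (mu : {measure set T -> \bar R}) (f : T -> R) (s t : R) :
  (s <= t)%R -> rearr mu f t <= rearr mu f s.
Proof.
move=> st; rewrite /rearr ge_max le_max lexx/= le_max; apply/orP; right.
apply: ereal_sup_le => _ [y [y0 h] <-]; exists y => //; split => //.
by apply: le_lt_trans h; rewrite lee_fin.
Qed.

Variables (P : probability T R) (f : T -> R).
Hypothesis mf : measurable_fun [set: T] f.

Let mnf : measurable_fun [set: T] (fun x => `|f x|%R).
Proof. exact: measurableT_comp. Qed.

Let mgt y : measurable [set x | (y < `|f x|)%R].
Proof.
by have := mnf measurableT (measurable_itv `]y, +oo[); rewrite setTI preimage_itvoy.
Qed.

(** The nontrivial direction is right continuity of the tail: if it exceeds t at y, it still does at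
    y + 1/(n+1) for some n, so the supremum lies strictly above y. *)
Lemma lt_rearr (y t : R) : (0 <= y)%R ->
  (y%:E < rearr P f t) = (t%:E < P [set x | (y < `|f x|)%R]).
Proof.
move=> y0; apply/idP/idP.
  rewrite /rearr lt_max => /orP[|/ereal_sup_gt[_ [z [z0 tz] <-]]].
    by rewrite lte_fin ltNge y0.
  rewrite lte_fin => yz; apply: lt_le_trans tz _.
  by apply: le_measure; rewrite ?inE// => x /=; exact: lt_trans.
move=> tP; pose F (n : nat) := [set x | (y + n.+1%:R^-1 < `|f x|)%R].
have FE : \bigcup_n F n = [set x | (y < `|f x|)%R].
  apply/seteqP; split => x /=; last by move=> /ltr_add_invr[n yn]; exists n.
  by move=> [n _]; apply: lt_trans; rewrite ltrDl invr_gt0.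
have mF n : measurable (F n) by exact: mgt.
have mFU : measurable (\bigcup_n F n) by rewrite FE; exact: mgt.
have ndF m n : (m <= n)%N -> F m `<=` F n.
  move=> mn x; rewrite /F/=; apply: le_lt_trans.
  by rewrite lerD2l lef_pV2 ?posrE// ler_nat.
have : P \o F @ \oo --> P (\bigcup_n F n).
  by apply: nondecreasing_cvg_mu => // m n mn; apply/subsetPset/ndF.
rewrite FE => /cvg_lim PF.
have [n tn] : exists n, t%:E < P (F n).
  apply: contrapT => /forallNP h.
  have : P [set x | (y < `|f x|)%R] <= t%:E.
    rewrite -PF//; apply: lime_le.
      apply: ereal_nondecreasing_is_cvgn => m n mn; apply: le_measure; rewrite ?inE//.
      exact: ndF.
    by apply: nearW => n; rewrite leNgt; apply/negP/h.
  by rewrite leNgt tP.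
have yn0 : (0 < n.+1%:R^-1 :> R)%R by rewrite invr_gt0.
apply: (@lt_le_trans _ _ (y + n.+1%:R^-1)%:E); first by rewrite lte_fin ltrDl.
rewrite /rearr le_max; apply/orP; right; apply: ereal_sup_ubound.
by exists (y + n.+1%:R^-1)%R => //; split => //; rewrite addr_ge0// ltW.
Qed.

Lemma rearr_fin (t : R) : (0 < t)%R -> rearr P f t \is a fin_num.
Proof.
move=> t0; rewrite ge0_fin_numE ?rearr_ge0//.
have [y y0 yt] := exists_tail_le P mnf t0.
apply: le_lt_trans (ltry y); rewrite leNgt lt_rearr//.
by rewrite -leNgt.
Qed.

Lemma rearr_ge1 (t : R) : (1 <= t)%R -> rearr P f t = 0.
Proof.
move=> t1; apply/eqP; rewrite eq_le rearr_ge0 andbT leNgt lt_rearr//.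
rewrite -leNgt; apply: (@le_trans _ _ 1); last by rewrite lee_fin.
exact: probability_le1.
Qed.

(** Since [fine] sends +oo to 0, [rstar] vanishes on negative numbers, as [decr01_measurable]
    requires. *)
Lemma rearr_lt0 (t : R) : (t < 0)%R -> rearr P f t = +oo.
Proof.
move=> t0; apply/eqP; rewrite -leye_eq leNgt; apply/negP => h.
have := rearr_ge0 P f t; case E : (rearr P f t) h => [y| |]//= _; rewrite lee_fin => y0.
have := @lt_rearr y t y0; rewrite E ltxx => /esym/negP; apply.
by apply: lt_le_trans (measure_ge0 _ _); rewrite lte_fin.
Qed.

Definition rstar : R -> R := fine \o rearr P f.

Lemma rstar_ge0 t : (0 <= rstar t)%R.
Proof. by rewrite fine_ge0// rearr_ge0. Qed.

Lemma lt_rstar (y t : R) : (0 <= y)%R -> (0 < t)%R ->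
  (y < rstar t)%R = (t%:E < P [set x | (y < `|f x|)%R]).
Proof.
by move=> y0 t0; rewrite -lt_rearr// -(fineK (rearr_fin t0)) lte_fin.
Qed.

Lemma rstar_nonincreasing (s t : R) : (0 < s)%R -> (s <= t)%R ->
  (rstar t <= rstar s)%R.
Proof.
move=> s0 st; rewrite -lee_fin /rstar/= !fineK ?rearr_fin ?(lt_le_trans s0)//.
exact: rearr_nonincreasing.
Qed.

End rearrangement.

(** Monotonicity stops short of 0, where [rearr] and [ell_tilde] may be infinite and [fine] then
    returns 0. *)
Definition decr01 (R : realType) (h : R -> R) := (forall t : R, 0 <= h t)%R /\
  (forall s t : R, 0 < s -> s <= t -> t <= 1 -> h t <= h s)%R.

Lemma decr01_measurable (R : realType) (h : R -> R) : decr01 h ->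
  (forall t, t < 0 -> h t = 0)%R -> (forall t, 1 < t -> h t = 0)%R ->
  measurable_fun [set: R] h.
Proof.
move=> [h0 hd] hlt hgt.
apply: (measurability _ (RGenOInfty.measurableE R)) => //.
move=> /= _ [_ [y ->] <-]; rewrite setTI preimage_itvoy.
have [y0|y0] := ltP y 0%R.
  rewrite (_ : [set _ | _] = setT)//; apply/seteqP; split => // x _ /=.
  exact: lt_le_trans (h0 x).
(* Apart from the point 0, whose value is arbitrary, a superlevel set is an interval by
   monotonicity. *)
rewrite (_ : [set _ | _] = [set t | t = 0 /\ y < h 0]%R `|`
    [set t | 0 < t <= 1 /\ y < h t]%R).
  apply: measurableU.
    have [yh|yh] := ltP y (h 0%R).
      by rewrite (_ : [set _ | _] = [set 0%R])//; apply/seteqP; split => t //= [].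
    by rewrite (_ : [set _ | _] = set0)//; apply/seteqP; split => t //= [].
  apply: is_interval_measurable => s t /= [/andP[s0 s1] ys] [/andP[t0 t1] yt] z.
  move=> /andP[sz zt]; split; first by rewrite (lt_le_trans s0)//= (le_trans zt).
  by apply: lt_le_trans yt _; apply: hd => //; exact: lt_le_trans sz.
apply/seteqP; split => t /=.
  move=> yt; have [t0|t0|t0] := ltgtP t 0%R.
  - by move: yt; rewrite hlt// ltNge y0.
  - right; split => //=; rewrite leNgt; apply/negP => t1.
    by move: yt; rewrite hgt// ltNge y0.
  - by left; split => //; rewrite -t0.
by move=> [[->]//|[]].
Qed.

Lemma rstar_measurable (R : realType) (d : measure_display) (T : measurableType d)
    (P : probability T R) (f : T -> R) :
  measurable_fun [set: T] f -> measurable_fun [set: R] (rstar P f).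
Proof.
move=> mf; apply: decr01_measurable => [|t t0|t t1].
- by split=> [t|s t s0 st _]; [exact: rstar_ge0|exact: rstar_nonincreasing].
- by rewrite /rstar/= rearr_lt0.
- by rewrite /rstar/= rearr_ge1// ltW.
Qed.

(** * Lebesgue measure on [0,1] and equimeasurability *)

Section unit_leb_lemmas.
Context (R : realType).
Implicit Types (A C : set R).

Lemma unit_leb_le A C : measurable A -> measurable C ->
  (forall t, 0 < t < 1 -> A t -> C t)%R -> unit_leb R A <= unit_leb R C.
Proof.
move=> mA mC AC; rewrite /unit_leb/= /mrestr.
have m01 : measurable (`[0%R, 1%R] : set R) by exact: measurable_itv.
apply: (@le_trans _ _ (lebesgue_measure
  ((C `&` `[0%R, 1%R]) `|` ([set 0%R] `|` [set 1%R])))).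
  apply: le_measure; rewrite ?inE.
  - exact: measurableI.
  - by apply: measurableU; [exact: measurableI|exact: measurableU].
  move=> t [At]; rewrite /= ?in_itv/= => /andP[t0 t1].
  have [->|tn0] := eqVneq t 0%R; first by right; left.
  have [->|tn1] := eqVneq t 1%R; first by right; right.
  left; split; last by rewrite /= ?in_itv/= t0.
  by apply: AC => //; rewrite !lt_neqAle t0 t1 tn1 eq_sym tn0.
rewrite measureU0//.
- exact: measurableI.
- exact: measurableU.
- by apply/eqP; rewrite -measure_le0 (le_trans (measureU2 _ _ _))//= !lebesgue_measure_set1 adde0.
Qed.

Lemma unit_leb_itv (x y : bool) (a b : R) :
  (0 <= a)%R -> (a <= b)%R -> (b <= 1)%R ->
  unit_leb R [set` Interval (BSide x a) (BSide y b)] = (b - a)%:E.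
Proof.
move=> a0 ab b1; rewrite /unit_leb/= /mrestr setIidl; last first.
  by move=> t; case: x; case: y; rewrite /= !in_itv/= => /andP[h1 h2]; apply/andP; split; lra.
rewrite lebesgue_measure_itv/= lte_fin; case: ltP => // ba.
by have -> : a = b; [apply/eqP; rewrite eq_le ab|rewrite subrr].
Qed.

Lemma unit_leb_setT : unit_leb R setT = 1.
Proof.
rewrite /unit_leb/= /mrestr setTI lebesgue_measure_itv/= lte_fin ltr01.
by rewrite oppr0 adde0.
Qed.

(** On ]0,1[ the condition y < [rstar P f t] reads t < P(|f| > y), so the superlevel set is an
    initial interval of the right length. *)
Lemma unit_leb_rstar (d : measure_display) (T : measurableType d)
    (P : probability T R) (f : T -> R) (y : R) :
  measurable_fun [set: T] f -> (0 <= y)%R ->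
  unit_leb R [set t | (y < `|rstar P f t|)%R] = P [set x | (y < `|f x|)%R].
Proof.
move=> mf y0; set a := P _.
have ma : measurable [set x | (y < `|f x|)%R].
  have mnf : measurable_fun [set: T] (fun x => `|f x|%R) by exact: measurableT_comp.
  by have := mnf measurableT _ (measurable_itv `]y, +oo[); rewrite setTI preimage_itvoy.
have afin : a \is a fin_num by rewrite fin_num_measure.
have a0 : (0 <= fine a)%R by rewrite /a fine_ge0.
have a1 : (fine a <= 1)%R by rewrite -lee_fin fineK//; exact: probability_le1.
have ms : measurable [set t | (y < `|rstar P f t|)%R].
  have mnf : measurable_fun [set: R] (fun x => `|rstar P f x|%R).
    by apply: measurableT_comp => //; exact: rstar_measurable.
  by have := mnf measurableT _ (measurable_itv `]y, +oo[); rewrite setTI preimage_itvoy.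
rewrite -[RHS]fineK// -[fine a]subr0 -(@unit_leb_itv false true)//.
have E t : (0 < t)%R -> (y < `|rstar P f t|)%R = (t < fine a)%R.
  by move=> t0; rewrite ger0_norm ?rstar_ge0// lt_rstar// -lte_fin fineK.
apply/eqP; rewrite eq_le; apply/andP; split; apply: unit_leb_le => //= t.
- by move=> /andP[t0 t1]; rewrite E// ?in_itv/= t0.
- by move=> /andP[t0 t1]; rewrite E// ?in_itv/= t0.
Qed.

End unit_leb_lemmas.

(** * Comparison and dilation in a rearrangement invariant space *)

Section ri_spaces.
Context (R : realType) (L : rv_space R).
Hypothesis riL : ri_space L.
Implicit Types f g h : R -> R.

Lemma measurable_norm_gtR h (y : R) : measurable_fun [set: R] h ->
  measurable [set t | (y < `|h t|)%R].
Proof.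
move=> mh; have mnh : measurable_fun [set: R] (fun x => `|h x|%R).
  exact: measurableT_comp.
by have := mnh measurableT _ (measurable_itv `]y, +oo[); rewrite setTI preimage_itvoy.
Qed.

Lemma ri_dist_le f g : measurable_fun [set: R] f -> rv_mem L g ->
  (forall y, (0 <= y)%R -> unit_leb R [set t | (y < `|f t|)%R] <=
                          unit_leb R [set t | (y < `|g t|)%R]) ->
  rv_mem L f /\ (rv_norm L f <= rv_norm L g)%R.
Proof.
move=> mf Lg fg; apply: (ri_rearr riL) => // t t0.
rewrite /rearr ge_max le_max lexx/= le_max; apply/orP; right.
apply: ereal_sup_le => _ [y [y0 ty] <-]; exists y => //; split => //.
exact: lt_le_trans ty (fg _ y0).
Qed.

Lemma ri_abs_le f g : measurable_fun [set: R] f -> rv_mem L g ->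
  (forall t, (0 < t < 1)%R -> (`|f t| <= `|g t|)%R) ->
  rv_mem L f /\ (rv_norm L f <= rv_norm L g)%R.
Proof.
move=> mf Lg fg; apply: ri_dist_le => // y y0; apply: unit_leb_le.
- exact: measurable_norm_gtR.
- by apply: measurable_norm_gtR; exact: (ri_meas riL).
- by move=> t t01 /= /lt_le_trans; apply; exact: fg.
Qed.

(* [g(t/2)] is equimeasurable with the sum of the copy of [g] on ]0,1/2[ and
   its mirror image on ]1/2,1[. *)
Lemma ri_dilate2 (K : R) g : quasi_constants L K -> rv_mem L g -> decr01 g ->
  rv_mem L (fun t => g (t / 2)%R) /\
  (rv_norm L (fun t => g (t / 2)%R) <= 2 * K * rv_norm L g)%R.
Proof.
move=> [K0 KL] Lg [g0 gd]; have mg := ri_meas riL Lg.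
pose I1 : set R := [set` `]0, 2^-1[%R]; pose I2 : set R := [set` `]2^-1, 1[%R].
pose f1 t := (g t * \1_I1 t)%R; pose f2 t := (g (1 - t) * \1_I2 t)%R.
have mf1 : measurable_fun [set: R] f1.
  by apply: measurable_funM => //; apply: measurable_indic; exact: measurable_itv.
have mf2 : measurable_fun [set: R] f2.
  apply: measurable_funM.
    by apply: measurableT_comp => //; apply: measurable_funB.
  by apply: measurable_indic; exact: measurable_itv.
have mh : measurable_fun [set: R] (fun t => g (t / 2)%R).
  by apply: measurableT_comp => //; apply: measurable_funM.
have f1E (t : R) : (0 < t < 2^-1)%R -> f1 t = g t.
  by move=> tI; rewrite /f1 indicE mem_set ?mulr1//= ?in_itv.
have f1E0 (t : R) : ~~ (0 < t < 2^-1)%R -> f1 t = 0%R.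
  by move=> tI; rewrite /f1 indicE memNset ?mulr0//= ?in_itv; exact/negP.
have f2E (t : R) : (2^-1 < t < 1)%R -> f2 t = g (1 - t)%R.
  by move=> tI; rewrite /f2 indicE mem_set ?mulr1//= ?in_itv.
have f2E0 (t : R) : ~~ (2^-1 < t < 1)%R -> f2 t = 0%R.
  by move=> tI; rewrite /f2 indicE memNset ?mulr0//= ?in_itv; exact/negP.
(* By monotonicity the part of a superlevel set of [g] in ]0,1/2[ is empty or, up to its right end,
   the interval ]0,c[. All measures below are then c or 2c. *)
have supP (y : R) : (0 <= y)%R -> (forall s : R, 0 < s < 2^-1 -> g s <= y)%R \/
   exists c : R, [/\ (0 < c <= 2^-1)%R, (forall s : R, 0 < s < 2^-1 -> y < g s -> s <= c)%R
      & (forall s : R, 0 < s < c -> y < g s)%R].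
  move=> y0; pose S := [set s | (0 < s < 2^-1 /\ y < g s)%R].
  have [S0|/set0P[s0 [s01 ys0]]] := eqVneq S set0.
    left => s s01; rewrite leNgt; apply/negP => ys.
    by have : S s by []; rewrite S0.
  have hS : has_sup S.
    by split; [exists s0|exists 2^-1%R => s [/andP[_ /ltW]]].
  right; exists (sup S); split.
  - apply/andP; split.
      by apply: (@lt_le_trans _ _ s0); [case/andP: s01|exact: ub_le_sup hS.2 _ _].
    by apply: ge_sup; [exists s0|move=> s [/andP[_ /ltW]]].
  - by move=> s s1 ys; apply: ub_le_sup hS.2 _ _.
  - move=> s /andP[s0' sS]; have sS' : (0 < sup S - s)%R by rewrite subr_gt0.
    have [z [/andP[z0 z1] yz]] := sup_adherent sS' hS.
    rewrite subKr => sz.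
    apply: lt_le_trans yz _; apply: gd => //; first exact: ltW.
    by rewrite (le_trans (ltW z1))// invf_le1// ler1n.
have [Lf1 nf1] : rv_mem L f1 /\ (rv_norm L f1 <= rv_norm L g)%R.
  apply: ri_abs_le => // t t01; have [tI|tI] := boolP (0 < t < 2^-1)%R.
    by rewrite f1E.
  by rewrite f1E0// normr0.
(* The mirrored copy is not dominated by [g] pointwise, only in distribution: its superlevel set
   lies in [1-c,1[ on ]0,1[. *)
have [Lf2 nf2] : rv_mem L f2 /\ (rv_norm L f2 <= rv_norm L g)%R.
  apply: ri_dist_le => // y y0.
  have [gy|[c [/andP[c0 c1] Sc cS]]] := supP y y0.
    apply: unit_leb_le => //; try exact: measurable_norm_gtR.
    move=> t t01 /=; have [tI|tI] := boolP (2^-1 < t < 1)%R; last first.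
      by rewrite f2E0// normr0 ltNge y0.
    rewrite f2E// ger0_norm// ltNge gy//.
    by move: tI; lra.
  apply: (@le_trans _ _ (unit_leb R `[(1 - c)%R, 1%R[%classic)).
    apply: unit_leb_le => //; first exact: measurable_norm_gtR.
    move=> t t01 /=; have [tI|tI] := boolP (2^-1 < t < 1)%R; last first.
      by rewrite f2E0// normr0 ltNge y0.
    rewrite f2E// ger0_norm// in_itv/= => yt.
    have : (1 - t <= c)%R by apply: Sc => //; lra.
    by lra.
  rewrite unit_leb_itv; [|lra..].
  rewrite (_ : 1 - (1 - c) = c - 0)%R; last by lra.
  rewrite -(@unit_leb_itv R false true)//; [|lra..].
  apply: unit_leb_le => //; try exact: measurable_norm_gtR.
  move=> t t01 /=; rewrite ?in_itv/= => tc; rewrite ger0_norm//.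
  exact: cS.
have Lf : rv_mem L (f1 \+ f2)%R by exact: (ri_add riL).
have [Lh nh] : rv_mem L (fun t => g (t / 2)%R) /\
    (rv_norm L (fun t => g (t / 2)%R) <= rv_norm L (f1 \+ f2)%R)%R.
  apply: ri_dist_le => // y y0.
  have mf : measurable_fun [set: R] (f1 \+ f2)%R by exact: measurable_funD.
  have [gy|[c [/andP[c0 c1] Sc cS]]] := supP y y0.
    apply: unit_leb_le => //; try exact: measurable_norm_gtR.
    by move=> t t01 /=; rewrite ger0_norm// ltNge gy//; lra.
  apply: (@le_trans _ _ (unit_leb R `[0%R, (2 * c)%R]%classic)).
    apply: unit_leb_le => //; first exact: measurable_norm_gtR.
    move=> t t01 /=; rewrite ger0_norm// in_itv/= => yt.
    have : (t / 2 <= c)%R by apply: Sc => //; lra.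
    by lra.
  rewrite unit_leb_itv; [|lra..].
  (* The length 2c is realised by the disjoint intervals ]0,c[ and ]1-c,1[, on which [f1] and [f2]
     respectively exceed y. *)
  rewrite (_ : 2 * c - 0 = (c - 0) + (1 - (1 - c)))%R; last by lra.
  rewrite EFinD -(@unit_leb_itv R false true 0 c); [|lra..].
  rewrite -(@unit_leb_itv R false true (1 - c) 1); [|lra..].
  rewrite -measureU//; last first.
    by apply/seteqP; split => // t [] /=; rewrite !in_itv/=; lra.
  apply: unit_leb_le => //; [exact: measurableU|exact: measurable_norm_gtR|].
  move=> t t01 /= [] /=; rewrite in_itv/= => tc.
  - rewrite f1E; last by lra.
    by rewrite f2E0 ?addr0 ?ger0_norm//; [exact: cS|lra].
  - rewrite f2E; last by lra.
    by rewrite f1E0 ?add0r ?ger0_norm//; [apply: cS; lra|lra].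
split => //; apply: (le_trans nh); apply: (le_trans (KL _ _ Lf1 Lf2)).
rewrite (mulrC 2%R) -mulrA ler_pM2l//; lra.
Qed.

End ri_spaces.

(** * L_p norms through tails *)

Definition unit_prob (R : realType) : probability (measurableTypeR R) R :=
  HB.pack (Measure.sort (unit_leb R))
    (Measure_isProbability.Build _ _ _ (unit_leb R) (unit_leb_setT R)).

Lemma ge0_integral_tail (R : realType) (d : measure_display)
    (T : measurableType d) (P : probability T R) (f : T -> R) :
  measurable_fun [set: T] f -> (forall x, 0 <= f x)%R ->
  \int[P]_x (f x)%:E =
  \int[lebesgue_measure]_(y in `[0%R, +oo[) P [set x | (y < f x)%R] /\
  measurable_fun [set: R] (fun y => P [set x | (y < f x)%R]).
Proof.
move=> mf f0.
pose X : {RV P >-> R} := HB.pack f (isMeasurableFun.Build _ _ _ _ f mf).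
have E : (fun y => P [set x | (y < f x)%R]) = ccdf X.
  apply/funext => y; rewrite /ccdf /distribution/= /pushforward.
  by rewrite preimage_itvoy.
split; last by rewrite E; exact: ccdf_measurable.
have := @ge0_expectation_ccdf _ _ _ P X f0; rewrite unlock => ->.
by rewrite -E.
Qed.

Section norm_comparison.
Context (R : realType) (d d' : measure_display) (T : measurableType d)
  (T' : measurableType d') (P : probability T R) (Q : probability T' R).

Lemma ge0_integral_tail_le (f : T -> R) (g : T' -> R) :
  measurable_fun [set: T] f -> measurable_fun [set: T'] g ->
  (forall x, 0 <= f x)%R -> (forall x, 0 <= g x)%R ->
  (forall y, (0 <= y)%R -> P [set x | (y < f x)%R] <= Q [set x | (y < g x)%R]) ->
  \int[P]_x (f x)%:E <= \int[Q]_x (g x)%:E.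
Proof.
move=> mf mg f0 g0 fg.
have [-> mP] := ge0_integral_tail P mf f0; have [-> mQ] := ge0_integral_tail Q mg g0.
apply: ge0_le_integral => //.
- exact: measurable_funTS.
- exact: measurable_funTS.
- by move=> y; rewrite /= in_itv/= andbT; exact: fg.
Qed.

Lemma measurable_norm_powR (d0 : measure_display) (T0 : measurableType d0)
    (f : T0 -> R) (p : R) : measurable_fun [set: T0] f ->
  measurable_fun [set: T0] (fun x => `|f x| `^ p)%R.
Proof.
move=> mf; apply: (measurableT_comp (measurable_powR p)).
exact: measurableT_comp.
Qed.

Lemma lt_powR_inv (p y z : R) : (0 < p)%R -> (0 <= y)%R -> (0 <= z)%R ->
  (y < z `^ p)%R = (y `^ p^-1 < z)%R.
Proof.
move=> p0 y0 z0; have p0' : (0 < p^-1)%R by rewrite invr_gt0.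
have powK (u s : R) : (0 < s)%R -> (0 <= u)%R -> ((u `^ s) `^ s^-1 = u)%R.
  by move=> s0 u0; rewrite -powRrM divff ?gt_eqF// powRr1.
apply/idP/idP => h.
- have := @gt0_ltr_powR _ _ p0' _ _ _ _ h; rewrite powK//; apply => //.
  by rewrite nnegrE powR_ge0.
- have := @gt0_ltr_powR _ _ p0 _ _ _ _ h.
  have := powK _ _ p0' y0; rewrite invrK => ->; apply => //.
  by rewrite nnegrE powR_ge0.
Qed.

(** The two functions live on different spaces, so the p-th powers are compared by the layer-cake
    formula, with |f|^p > y read as |f| > y^(1/p). *)
Lemma Lnorm_tail_le (p : R) (f : T -> R) (g : T' -> R) : (0 < p)%R ->
  measurable_fun [set: T] f -> measurable_fun [set: T'] g ->
  (forall y, (0 <= y)%R ->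
     P [set x | (y < `|f x|)%R] <= Q [set x | (y < `|g x|)%R]) ->
  'N[P]_p%:E[EFin \o f] <= 'N[Q]_p%:E[EFin \o g].
Proof.
move=> p0 mf mg fg; rewrite unlock /Lnorm.
apply: gt0_ler_poweR.
- by rewrite invr_ge0 ltW.
- by rewrite in_itv/= leey andbT; apply: integral_ge0 => x _; rewrite lee_fin powR_ge0.
- by rewrite in_itv/= leey andbT; apply: integral_ge0 => x _; rewrite lee_fin powR_ge0.
apply: ge0_integral_tail_le.
- exact: measurable_norm_powR.
- exact: measurable_norm_powR.
- by move=> x; exact: powR_ge0.
- by move=> x; exact: powR_ge0.
move=> y y0.
have E (T0 : Type) (h : T0 -> R) : [set x | (y < `|h x| `^ p)%R] =
    [set x | (y `^ p^-1 < `|h x|)%R].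
  by apply/seteqP; split => x /=; rewrite lt_powR_inv.
by rewrite !E; apply: fg; exact: powR_ge0.
Qed.

Lemma markov_Lnorm (p A a : R) (f : T -> R) : (0 < p)%R -> (0 < a)%R ->
  measurable_fun [set: T] f -> 'N[P]_p%:E[EFin \o f] <= A%:E ->
  (a `^ p)%:E * P [set x | (a < `|f x|)%R] <= (A `^ p)%:E.
Proof.
move=> p0 a0 mf fA.
pose X : {RV P >-> R} := HB.pack f (isMeasurableFun.Build _ _ _ _ f mf).
have A0 : (0 <= A)%R by rewrite -lee_fin; apply: le_trans fA; exact: Lnorm_ge0.
have mnf : measurable_fun [set: T] (fun x => `|f x|%R) by exact: measurableT_comp.
apply: (@le_trans _ _ ('N[P]_p%:E[EFin \o f] `^ p)); last first.
  rewrite -poweR_EFin; apply: gt0_ler_poweR => //; first exact: ltW.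
  - by rewrite in_itv/= leey andbT Lnorm_ge0.
  - by rewrite in_itv/= leey andbT lee_fin.
rewrite poweR_Lnorm ?gt_eqF//.
have := @markov _ _ _ P X (fun r => r `^ p)%R a a0 (measurable_powR p).
rewrite unlock; set lhs := _ * _ => h.
apply: (@le_trans _ _ lhs); last first.
  apply: h => [r r0|x y x0 y0 xy]; first exact: powR_ge0.
  by apply: ge0_ler_powR => //; exact: ltW.
rewrite /lhs lee_wpmul2l//; first by rewrite lee_fin powR_ge0.
(* [markov] bounds the closed level set |f| >= a, which contains the open one. *)
apply: le_measure; rewrite ?inE.
- by have := mnf measurableT _ (measurable_itv `]a, +oo[); rewrite setTI preimage_itvoy.
- have := mnf measurableT _ (measurable_itv `[a, +oo[); rewrite setTI preimage_itvcy.
  by congr measurable; apply/seteqP; split => x.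
- by move=> x /=; rewrite lee_fin => /ltW.
Qed.

End norm_comparison.

(** On ]0,1[ the q-th power is at most t^(-1/2), whose tail is at most min(1, y^(-2)) <= 2/(1 +
    y^2). The integral of this majorant over the half-line is pi, the constant in the bound. *)
Lemma Lnorm_powR_le (R : realType) (q b : R) : (0 < q)%R -> (0 <= b)%R ->
  (b * q <= 2^-1)%R ->
  'N[unit_leb R]_q%:E[EFin \o (fun t : R => t `^ (- b))%R] <= (pi `^ q^-1)%:E.
Proof.
move=> q0 b0 bq; rewrite unlock /Lnorm -poweR_EFin.
have mW : measurable_fun [set: R] (fun t : R => `|t `^ (- b)| `^ q)%R.
  by apply: measurable_norm_powR; exact: measurable_powR.
apply: gt0_ler_poweR.
- by rewrite invr_ge0 ltW.
- by rewrite in_itv/= leey andbT; apply: integral_ge0 => x _; rewrite lee_fin powR_ge0.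
- by rewrite in_itv/= leey andbT lee_fin pi_ge0.
have W0 (t : R) : (0 <= `|t `^ (- b)| `^ q)%R by exact: powR_ge0.
have [E mE] := @ge0_integral_tail _ _ _ (unit_prob R) _ mW W0.
rewrite [leLHS]E.
have -> : pi%:E = (2%:E * (pi / 2)%:E : \bar R) by rewrite -EFinM mulrC divfK.
have mD : measurable_fun [set: R] (fun x : R => (oneDsqr x)^-1)%R.
  by apply: continuous_measurable_fun; exact: continuous_oneDsqrV.
have D0 (x : R) : (0 <= (oneDsqr x)^-1)%R by rewrite invr_ge0 (le_trans ler01)// oneDsqr_ge1.
rewrite -integral0y_oneDsqr -ge0_integralZl//=; first last.
- by apply/measurable_EFinP; exact: measurable_funTS.
apply: ge0_le_integral => //.
- exact: measurable_funTS.
- by apply/measurable_EFinP; apply: measurable_funTS; exact: measurable_funM.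
move=> y; rewrite /= in_itv/= andbT => y0.
have ms : measurable [set t : R | (y < `|t `^ (- b)| `^ q)%R].
  by have := mW measurableT _ (measurable_itv `]y, +oo[); rewrite setTI preimage_itvoy.
rewrite -EFinM.
(* For y <= 1 the trivial bound 1 suffices; for y > 1 the level set meets ]0,1[ inside ]0,
   y^(-2)]. *)
have [y1|y1] := leP y 1%R.
  apply: (@le_trans _ _ 1); first exact: (@probability_le1 _ _ _ (unit_prob R)).
  by rewrite lee_fin ler_pdivlMr ?(lt_le_trans ltr01 (oneDsqr_ge1 _))// /oneDsqr; nra.
have yy : (0 < y ^+ 2)%R by rewrite exprn_gt0// (lt_trans ltr01).
have yy1 : (1 < y ^+ 2)%R by rewrite exprn_egt1.
apply: (@le_trans _ _ (unit_leb R `]0%R, (y ^+ 2)^-1%R]%classic)).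
  apply: unit_leb_le => // t /andP[t0 t1] /=.
  rewrite ger0_norm ?powR_ge0// in_itv/= t0/= -powRrM mulNr => yt.
  have t12 : (y < t `^ (- 2^-1))%R.
    apply: lt_le_trans yt _; apply: ger_powR; first by rewrite t0 ltW.
    by rewrite lerN2.
  have tpos : (0 < t `^ 2^-1)%R by exact: powR_gt0.
  have tt : ((t `^ 2^-1) ^+ 2 = t)%R.
    by rewrite -powR_mulrn ?powR_ge0// -powRrM mulVf// powRr1// ltW.
  rewrite powRN in t12.
  rewrite -[t]tt -exprVn ler_pXn2r ?nnegrE ?invr_ge0 ?(ltW tpos)//.
  by rewrite -[leLHS]invrK lef_pV2 ?posrE ?invr_gt0// ?(lt_trans ltr01)// ltW.
rewrite unit_leb_itv//; last 2 first.
- by rewrite invr_ge0 ltW.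
- by rewrite invf_le1// ltW.
rewrite subr0 lee_fin ler_pdivlMr ?(lt_le_trans ltr01 (oneDsqr_ge1 _))//.
by rewrite ler_pdivrMl// /oneDsqr; lra.
Qed.

Lemma ri_dilate (R : realType) (L : rv_space R) (K : R) (g : R -> R) (m : nat) :
  ri_space L -> quasi_constants L K -> rv_mem L g -> decr01 g ->
  rv_mem L (fun t => g (t / 2 ^+ m)%R) /\
  (rv_norm L (fun t => g (t / 2 ^+ m)%R) <= (2 * K) ^+ m * rv_norm L g)%R.
Proof.
move=> riL KL Lg dg; elim: m => [|m [IHL IHn]].
  have -> : (fun t => g (t / 2 ^+ 0)%R) = g.
    by apply/funext => t; rewrite expr0 divr1.
  by rewrite expr0 mul1r.
have p0 : (0 < 2 ^+ m :> R)%R by exact: exprn_gt0.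
have dm : decr01 (fun t => g (t / 2 ^+ m)%R).
  split=> [t|s t s0 st t1]; first exact: dg.1.
  apply: dg.2; rewrite ?divr_gt0 ?ler_pM2r ?invr_gt0//.
  by rewrite ler_pdivrMr// mul1r (le_trans t1)// exprn_ege1// ler1n.
have [h1 h2] := ri_dilate2 riL KL IHL dm.
have -> : (fun t => g (t / 2 ^+ m.+1)%R) = (fun t => g (t / 2 / 2 ^+ m)%R).
  by apply/funext => t; rewrite exprS invfM mulrA.
split=> //; apply: le_trans h2 _.
rewrite exprS -[leRHS]mulrA ler_wpM2l//; case: KL => /ltW K0 _.
by rewrite mulr_ge0.
Qed.

(** * Pointwise comparison of the rearrangement of U with ell *)

Section sums.
Context (R : realType) (B : normedModType R) (d : measure_display)
  (T : measurableType d) (P : probability T R) (N : nat) (X : 'I_N -> T -> B).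
Hypothesis rX : forall n, random_vector (X n).
Hypothesis indepX : independent_family P X.

Let U := max_partial_sum X.
Let mU : measurable_fun [set: T] U := measurable_max_partial_sum rX.

Let normU x : `|U x|%R = U x.
Proof. by rewrite ger0_norm// max_partial_sum_ge0. Qed.

Definition ellstar : R -> R := fine \o ell P X.

Lemma ellstar_ge0 t : (0 <= ellstar t)%R.
Proof. by rewrite fine_ge0// /ell; case: ifP => // _; exact: ell_tilde_ge0. Qed.

Lemma ellstarE t : (0 < t <= 1)%R -> (ellstar t)%:E = ell_tilde P X t.
Proof. by move=> /andP[t0 t1]; rewrite /ellstar/= /ell t1 fineK// ell_tilde_fin. Qed.

Lemma decr01_ellstar : decr01 ellstar.
Proof.
split=> [t|s t s0 st t1]; first exact: ellstar_ge0.
rewrite -lee_fin !ellstarE ?s0 ?(le_trans st)// ?(lt_le_trans s0)//.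
exact: ell_tilde_nonincreasing.
Qed.

Lemma measurable_ellstar : measurable_fun [set: R] ellstar.
Proof.
apply: decr01_measurable => [|t t0|t t1]; first exact: decr01_ellstar.
- rewrite /ellstar/= /ell (le_trans (ltW t0))// /ell_tilde.
  rewrite (_ : [set _ | _] = set0) ?ereal_inf0//.
  apply/seteqP; split => // y [_ /=]; apply/negP; rewrite -ltNge.
  by apply: (@lt_le_trans _ _ 0); rewrite ?lte_fin ?sume_ge0.
- by rewrite /ellstar/= /ell leNgt t1.
Qed.

Lemma ellstar_le_rstar t : (0 < t <= 1)%R ->
  (ellstar t <= 2 * rstar P U (t / 2 ^+ 2))%R.
Proof.
move=> /andP[t0 t1]; rewrite leNgt; apply/negP.
set z := rstar P U _ => zt; have z0 : (0 <= z)%R by exact: rstar_ge0.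
(* If ell(t) > 2z, the tails at 2z sum to more than t, hence P(U > z) > t/2 >= t/4, contradicting z
   = U^*(t/4). *)
have := @lt_sum_tails _ _ _ _ P _ X (2 * z)%R t.
rewrite -ellstarE ?t0// lte_fin => /(_ _ zt) h.
have {}h := h (mulr_ge0 (ler0n _ 2) z0).
have t01 : (0 <= t <= 1)%R by rewrite ltW.
have := sum_tails_le_max rX indepX t01 h; rewrite (mulrC 2%R z) mulfK// => hU.
have t40 : (0 < t / 2 ^+ 2)%R by rewrite divr_gt0.
have := lt_rstar P mU z0 t40; rewrite -/z ltxx => /esym/negP; apply.
under eq_set do rewrite normU.
by apply: le_lt_trans hU; rewrite lee_fin; lra.
Qed.

Lemma max_partial_sum_tail (n : nat) (p A t e : R) : (0 < p)%R -> (0 < A)%R ->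
  'N[P]_p%:E[EFin \o U] <= A%:E -> (0 < t <= 1)%R -> (0 < e)%R ->
  P [set x | (4 ^+ n * (A * t `^ (- ((2 ^ n)%:R^-1 / p)) + (ellstar t + e))
              < U x)%R] <= (hj_const R n * t)%:E.
Proof.
move=> p0 A0 UA t01 e0; have /andP[t0 t1] := t01.
(* The initial tail bound that n squarings turn into t. The factor [W] satisfies [W]^p = 1/u, so
   Markov at level A [W] yields exactly u. *)
set u := (t `^ (2 ^ n)%:R^-1)%R.
have n0 : ((2 ^ n)%:R != 0 :> R)%R by rewrite pnatr_eq0 expn_eq0.
have utE : (u ^+ (2 ^ n) = t)%R.
  by rewrite -powR_mulrn ?powR_ge0// -powRrM mulVf// powRr1// ltW.
have u0 : (0 < u)%R by exact: powR_gt0.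
have u1 : (u <= 1)%R.
  by rewrite -(@powRr0 _ t); apply: ger_powR.
set W := (t `^ _)%R.
have W0 : (0 < W)%R by exact: powR_gt0.
have Wp : (W `^ p = u^-1)%R.
  by rewrite /W -powRrM mulNr divfK ?gt_eqF// powRN.
(* The starting level A [W] + (ellstar t + e) contains the summand bound as a term, which ensures
   the hypothesis m <= A of the iteration. *)
rewrite -[X in (_ * X)%:E]utE; apply: (@hoffmann_jorgensen_iter _ _ _ _ P _ _ rX n _ (ellstar t + e)%R) => //.
- apply/andP; split; first by rewrite addr_ge0 ?ellstar_ge0// ltW.
  by rewrite lerDr mulr_ge0// ltW.
- by rewrite (ltW u0).
- have AW0 : (0 < A * W)%R by exact: mulr_gt0.
  apply: (@le_trans _ _ (P [set x | (A * W < `|U x|)%R])).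
    apply: le_measure; rewrite ?inE; try exact: measurable_max_partial_sum_gt.
      by under eq_set do rewrite normU; exact: measurable_max_partial_sum_gt.
    move=> x /=; rewrite normU; apply: le_lt_trans.
    by rewrite lerDl addr_ge0 ?ellstar_ge0// ltW.
  have := markov_Lnorm p0 AW0 mU UA.
  have mAW : measurable [set x | (A * W < `|U x|)%R].
    by under eq_set do rewrite normU; exact: measurable_max_partial_sum_gt.
  rewrite -(fineK (fin_num_measure P _ mAW)) -EFinM !lee_fin.
  rewrite powRM ?(ltW A0) ?(ltW W0)// Wp -mulrA ger_pMr ?powR_gt0//.
  by rewrite mulrC ler_pdivrMr// mul1r.
- rewrite utE; apply: sum_tails_le => //; rewrite -ellstarE// lte_fin.
  by rewrite ltrDl.
Qed.

(** The tail bound is taken at s = t/2^m, where D_n s <= t, and then e tends to 0. *)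
Lemma rstar_max_le (n m : nat) (p A t s : R) : (0 < p)%R -> (0 < A)%R ->
  'N[P]_p%:E[EFin \o U] <= A%:E -> (0 < t <= 1)%R -> (hj_const R n <= 2 ^+ m)%R ->
  s = (t / 2 ^+ m)%R ->
  (rstar P U t <= 4 ^+ n * (A * s `^ (- ((2 ^ n)%:R^-1 / p)) + ellstar s))%R.
Proof.
move=> p0 A0 UA /andP[t0 t1] nm sE.
have m0 : (0 < 2 ^+ m :> R)%R by exact: exprn_gt0.
have s0 : (0 < s)%R by rewrite sE divr_gt0.
have s1 : (s <= 1)%R.
  by rewrite sE ler_pdivrMr// mul1r (le_trans t1)// exprn_ege1// ler1n.
apply/ler_addgt0Pr => e e0.
have n0 : (0 < 4 ^+ n :> R)%R by exact: exprn_gt0.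
have s01 : (0 < s <= 1)%R by rewrite s0.
have en0 : (0 < e / 4 ^+ n)%R by rewrite divr_gt0.
have := max_partial_sum_tail n p0 A0 UA s01 en0.
set y := (4 ^+ n * _)%R.
have -> : (4 ^+ n * (A * s `^ (- ((2 ^ n)%:R^-1 / p)) + ellstar s) + e)%R = y.
  by rewrite /y addrA [in RHS]mulrDr (mulrC _ (e / _)%R) divfK ?gt_eqF.
have y0 : (0 <= y)%R.
  rewrite /y mulr_ge0 ?(ltW n0)// !addr_ge0 ?ellstar_ge0 ?(ltW en0)//.
  by rewrite mulr_ge0 ?powR_ge0// ltW.
move=> h; rewrite leNgt lt_rstar// -leNgt.
under eq_set do rewrite normU.
apply: le_trans h _; rewrite lee_fin sE mulrCA ger_pMr//.
by rewrite ler_pdivrMr// mul1r.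
Qed.

End sums.

(** * The two norm inequalities *)

Section norm_bounds.
Context (R : realType) (L : rv_space R) (K C1 C2 p q : R).
Hypotheses (riL : ri_space L) (p0 : (0 < p)%R) (pq : (p <= q)%R).
Hypothesis KL : quasi_constants L K.
Context (B : normedModType R) (d : measure_display) (T : measurableType d)
  (P : probability T R) (N : nat) (X : 'I_N -> T -> B).
Hypothesis rX : forall n, random_vector (X n).
Hypothesis indepX : independent_family P X.

Let U := max_partial_sum X.
Let mU : measurable_fun [set: T] U := measurable_max_partial_sum rX.

(** [C1] pays for |U|_p, carried over to [0,1] by equimeasurability; ell(t) <= 2 U^*(t/4) costs the
    factor 2 and two dilations by 2, each a factor 2K. *)
Lemma ri_norm_max_ge : embedding_constants L (Lp p) C1 -> rv_mem L (rstar P U) ->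
  'N[P]_p%:E[EFin \o U] + ext_norm L (ellstar P X) <=
  ((C1 + 2 * (2 * K) ^+ 2) * rv_norm L (rstar P U))%:E.
Proof.
move=> [C10 C1L] LU; rewrite mulrDl EFinD; apply: leeD.
  have [[_ fin_s] le_s] := C1L _ LU.
  apply: (@le_trans _ _ 'N[unit_leb R]_p%:E[EFin \o rstar P U]).
    apply: (@Lnorm_tail_le _ _ _ _ _ P (unit_prob R)) => //.
      exact: rstar_measurable.
    by move=> y y0; rewrite [leRHS]unit_leb_rstar.
  by rewrite -lee_fin fineK ?ge0_fin_numE ?Lnorm_ge0// in le_s.
have dU : decr01 (rstar P U).
  by split=> [t|s t s0 st _]; [exact: rstar_ge0|exact: rstar_nonincreasing].
have [L4 n4] := ri_dilate 2 riL KL LU dU.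
have [Lell nell] : rv_mem L (ellstar P X) /\
    (rv_norm L (ellstar P X) <=
     rv_norm L (2 \*o (fun t => rstar P U (t / 2 ^+ 2))))%R.
  apply: ri_abs_le => //.
  - exact: measurable_ellstar.
  - exact: (ri_scale riL).
  move=> t /andP[t0 t1]; rewrite !ger0_norm ?ellstar_ge0//=.
    by apply: ellstar_le_rstar => //; rewrite t0 ltW.
  by rewrite mulr_ge0// rstar_ge0.
rewrite /ext_norm asboolT// lee_fin (le_trans nell)//.
rewrite (ri_normZ riL)// ger0_norm// -mulrA ler_pM2l//.
Qed.

Lemma ri_norm_max_le (n m : nat) (M : R) : embedding_constants (Lp q) L C2 ->
  (2 * (q / p) <= (2 ^ n)%:R)%R -> (hj_const R n <= 2 ^+ m)%R ->
  (pi `^ q^-1 <= M)%R -> 'N[P]_p%:E[EFin \o U] < +oo ->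
  rv_mem L (ellstar P X) ->
  rv_mem L (rstar P U) /\
  (rv_norm L (rstar P U) <= (2 * K) ^+ m * 4 ^+ n * K * (C2 * M + 1) *
     (fine 'N[P]_p%:E[EFin \o U] + rv_norm L (ellstar P X)))%R.
Proof.
move=> [C20 C2L] rn hjm piM Ufin Lell; have [K0 KL'] := KL.
have q0 : (0 < q)%R by exact: lt_le_trans pq.
set b := ((2 ^ n)%:R^-1 / p)%R.
have n20 : (0 < (2 ^ n)%:R :> R)%R by rewrite ltr0n expn_gt0.
have b0 : (0 < b)%R by rewrite divr_gt0// invr_gt0.
have bq : (b * q <= 2^-1)%R.
  rewrite /b -mulrA ler_pdivrMl// (mulrC p^-1%R).
  by rewrite ler_pdivlMr// (mulrC (q / p)%R).
pose W t : R := (t `^ (- b))%R.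
have W0 t : (0 <= W t)%R by exact: powR_ge0.
have WN := Lnorm_powR_le q0 (ltW b0) bq.
have LqW : rv_mem (Lp q) W.
  split; first exact: measurable_powR.
  by apply: le_lt_trans WN _; rewrite ltry.
have [LW nW] := C2L _ LqW.
have {}nW : (rv_norm L W <= C2 * M)%R.
  apply: le_trans nW _; rewrite ler_pM2l//; apply: le_trans piM.
  by rewrite -lee_fin fineK// ge0_fin_numE ?Lnorm_ge0//; exact: LqW.2.
have N0 : (0 <= fine 'N[P]_p%:E[EFin \o U])%R by rewrite fine_ge0// Lnorm_ge0.
have ell0 : (0 <= rv_norm L (ellstar P X))%R by exact: (ri_norm_ge0 riL).
have CM0 : (0 <= C2 * M)%R by apply: le_trans nW; exact: (ri_norm_ge0 riL).
(* Markov's bound needs a positive level, while |U|_p may be 0; hence a variable A > 0 above it. The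
   factors of the constant come from the dilation, the level 4^n, the quasi-triangle inequality, and
   the norms of [W] and ell. *)
have step (A : R) : (0 < A)%R -> 'N[P]_p%:E[EFin \o U] <= A%:E ->
    rv_mem L (rstar P U) /\
    (rv_norm L (rstar P U) <= (2 * K) ^+ m * 4 ^+ n * K * (C2 * M + 1) *
      (A + rv_norm L (ellstar P X)))%R.
  move=> A0 UA.
  pose g : R -> R := (4 ^+ n \*o ((A \*o W) \+ ellstar P X))%R.
  have LAW : rv_mem L (A \*o W)%R by exact: (ri_scale riL).
  have Ls : rv_mem L ((A \*o W) \+ ellstar P X)%R by exact: (ri_add riL).
  have Lg : rv_mem L g by exact: (ri_scale riL).
  have n40 : (0 < 4 ^+ n :> R)%R by exact: exprn_gt0.
  have ng : (rv_norm L g <= 4 ^+ n * K * (C2 * M + 1) *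
      (A + rv_norm L (ellstar P X)))%R.
    rewrite (ri_normZ riL)// ger0_norm ?(ltW n40)// -!mulrA ler_pM2l//.
    apply: le_trans (KL' _ _ LAW Lell) _; rewrite ler_pM2l//.
    rewrite (ri_normZ riL)// ger0_norm ?(ltW A0)//.
    have : (A * rv_norm L W <= A * (C2 * M))%R by rewrite ler_pM2l.
    by nra.
  have g0 t : (0 <= g t)%R.
    by rewrite /g/= mulr_ge0 ?(ltW n40)// addr_ge0 ?ellstar_ge0// mulr_ge0// ltW.
  have dg : decr01 g.
    split=> // s t s0 st t1; rewrite /g/= ler_pM2l// lerD//.
      rewrite ler_pM2l// /W !powRN lef_pV2 ?posrE ?powR_gt0//; last first.
        exact: lt_le_trans st.
      by apply: ge0_ler_powR; rewrite ?nnegrE ?(ltW b0)// ltW// (lt_le_trans s0).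
    by have [_] := decr01_ellstar P rX; apply.
  have [Ld nd] := ri_dilate m riL KL Lg dg.
  have [LU nU] : rv_mem L (rstar P U) /\
      (rv_norm L (rstar P U) <= rv_norm L (fun t => g (t / 2 ^+ m)))%R.
    apply: ri_abs_le => //; first exact: rstar_measurable.
    move=> t /andP[t0 t1]; rewrite !ger0_norm ?rstar_ge0//.
    by apply: (rstar_max_le rX indepX p0 A0 UA _ hjm) => //; rewrite t0 ltW.
  split=> //; apply: le_trans nU _; apply: le_trans nd _.
  rewrite -!mulrA in ng *; rewrite ler_wpM2l// exprn_ge0//.
  by rewrite mulr_ge0// ltW.
have NE : 'N[P]_p%:E[EFin \o U] = (fine 'N[P]_p%:E[EFin \o U])%:E.
  by rewrite fineK// ge0_fin_numE ?Lnorm_ge0.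
set c := (_ * _ * _ * (C2 * M + 1))%R in step *.
have c0 : (0 < c)%R.
  by rewrite /c !mulr_gt0 ?exprn_gt0 ?mulr_gt0// ltr_wpDl.
split.
  apply: (step (fine 'N[P]_p%:E[EFin \o U] + 1)%R _ _).1.
    by rewrite ltr_wpDl.
  by rewrite {1}NE lee_fin lerDl.
apply/ler_addgt0Pr => e e0.
(* Membership was obtained with A = |U|_p + 1; the sharp bound comes from A = |U|_p + e/c as e tends
   to 0. *)
have ec0 : (0 < e / c)%R by rewrite divr_gt0.
have [||_] := step (fine 'N[P]_p%:E[EFin \o U] + e / c)%R.
- by rewrite ltr_wpDl.
- by rewrite {1}NE lee_fin lerDl ltW.
move=> /le_trans; apply.
by rewrite addrAC mulrDr (mulrC c (e / c)%R) divfK ?gt_eqF.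
Qed.

End norm_bounds.

Theorem theorem7p1 (R : realType) (p0 K C1 C2 r : R) (hp0 : (0 < p0)%R) :
  exists2 c : R, (0 < c)%R &
    forall (L : rv_space R) (p q : R),
      ri_space L -> (p0 <= p)%R -> (p <= q)%R -> (q / p)%R = r ->
      is_least (quasi_constants L) K ->
      is_least (embedding_constants L (Lp p)) C1 ->
      is_least (embedding_constants (Lp q) L) C2 ->
    forall (B : completeNormedModType R) (d : measure_display)
      (T : measurableType d) (P : probability T R)
      (N : nat) (X : 'I_N -> T -> B),
      (forall n, random_vector (X n)) -> independent_family P X ->
      let U := max_partial_sum X in
      let S := 'N[P]_p%:E[EFin \o U] + ext_norm L (fine \o ell P X) in
      c^-1%:E * S <= ri_norm L P U /\ ri_norm L P U <= c%:E * S.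
Proof.
have le_pow2 (x : R) : exists n : nat, (x <= (2 ^ n)%:R)%R.
  exists (Num.truncn `|x|).+1; apply: (le_trans (ler_norm x)).
  apply: (le_trans (ltW (truncnS_gt _))); rewrite ler_nat ltnW//.
  exact: ltn_expl.
have [n rn] := le_pow2 (2 * r)%R.
have [m hjm] := le_pow2 (hj_const R n); rewrite natrX in hjm.
(* Bounds pi^(1/q) for all q >= [p0]; a base at least 1 makes the power increase with the
   exponent. *)
pose M : R := ((1 + pi) `^ p0^-1)%R.
pose cu : R := ((2 * K) ^+ m * 4 ^+ n * K * (C2 * M + 1))%R.
pose cl : R := (C1 + 2 * (2 * K) ^+ 2)%R.
(* The witness precedes any space, when [K], [C1] and [C2] are arbitrary reals; absolute values and
   the 1 make it positive. *)
exists (`|cu| + `|cl| + 1)%R; first by rewrite ltr_wpDl// addr_ge0.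
set c := (_ + 1)%R.
have c0 : (0 < c)%R by rewrite ltr_wpDl// addr_ge0.
move=> L p q riL p0p pq qpr [KL _] [C1L _] [C2L _] B d T P N X rX indepX U S.
have p_gt0 : (0 < p)%R by exact: lt_le_trans p0p.
have q_gt0 : (0 < q)%R by exact: lt_le_trans pq.
have S_ge0 : 0 <= ext_norm L (fine \o ell P X).
  rewrite /ext_norm; case: asboolP => // Lell; rewrite lee_fin.
  exact: (ri_norm_ge0 riL).
have N_ge0 : 0 <= 'N[P]_p%:E[EFin \o U] by exact: Lnorm_ge0.
rewrite -[fine \o ell P X]/(ellstar P X) in S S_ge0 *.
rewrite /ri_norm -[fine \o rearr P U]/(rstar P U).
split.
  rewrite /ext_norm; case: asboolP => [LU|_]; last by rewrite leey.
  have h := ri_norm_max_ge riL p_gt0 KL rX indepX C1L LU.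
  rewrite lee_pdivrMl// -EFinM; apply: le_trans h _; rewrite lee_fin.
  rewrite ler_wpM2r ?(ri_norm_ge0 riL)// (le_trans (ler_norm _))// /c.
  by rewrite addrAC lerDr addr_ge0.
(* If ell is outside the space or |U|_p is infinite, then S = +oo, because both terms are
   nonnegative, and the upper bound is trivial. *)
have [Lell|nLell] := pselect (rv_mem L (ellstar P X)); last first.
  have -> : S = +oo.
    by rewrite /S /ext_norm asboolF// addey// gt_eqF// (lt_le_trans _ N_ge0).
  by rewrite gt0_muley ?leey.
have [Ufin|] := ltP 'N[P]_p%:E[EFin \o U] +oo; last first.
  rewrite leye_eq => /eqP Uoo; rewrite /S Uoo addye ?gt0_muley ?leey//.
  by rewrite gt_eqF// (lt_le_trans _ S_ge0).
have piM : (pi `^ q^-1 <= M)%R.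
  apply: (@le_trans _ _ ((1 + pi) `^ q^-1)%R).
    have pi0 : (0 <= pi :> R)%R by exact: pi_ge0.
    apply: ge0_ler_powR; rewrite ?nnegrE ?invr_ge0 ?lerDr//; first exact: ltW.
    exact: addr_ge0.
  apply: ler_powR; first by rewrite lerDl pi_ge0.
  by rewrite lef_pV2 ?posrE// (le_trans p0p).
rewrite -qpr in rn.
have [LU nU] := ri_norm_max_le riL p_gt0 pq KL rX indepX C2L rn hjm piM Ufin Lell.
rewrite /S /ext_norm !asboolT// -(fineK (x := 'N[P]_p%:E[_])); last first.
  by rewrite ge0_fin_numE.
rewrite -EFinD -EFinM lee_fin; apply: le_trans nU _.
rewrite ler_wpM2r ?addr_ge0 ?fine_ge0 ?(ri_norm_ge0 riL)//.
by rewrite (le_trans (ler_norm _))// /c -addrA lerDl addr_ge0.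
Qed.
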